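(* Let $m\ge1$, $N=2^m$, let $L\ge1$ be an integer, $T>0$, $B,J\in\mathbb{R}$, and $\Delta=T/(L+1)$. Let $U(B,J)$ be the digital-adiabatic $N$-qubit unitary, $\mathcal{B}=b_1^\dagger b_1$ the mode-occupation observable, and let $|\Phi\rangle$, $A$, $S_0$, $\widetilde S_1(l)$, $\tau(l)$, $R(B,J)$ be the objects on $m+1$, respectively $m+2$, qubits given in the context. Then: (1) The $N$-qubit expectation value is obtained from a measurement of $Y$ on the last qubit of an $(m+1)$-qubit state: $$\langle 0|^{\otimes N}\,U(B,J)^\dagger\,\mathcal{B}\,U(B,J)\,|0\rangle^{\otimes N}=-\frac12\,\langle\Phi|R(B,J)\,Y_m\,R(B,J)^{\mathsf T}|\Phi\rangle .$$ (2) With one auxiliary qubit $\mathrm{a}$ prepared in $|+\rangle$, the transformation $R(B,J)^{\mathsf T}$ can be realized by replacing, in each of its $L+1$ steps, $R_0^{\mathsf T}=\mathbb{1}\otimes S_0$ by $R_0^{\mathsf T}\otimes\mathbb{1}_{\mathrm a}$ and, in $R_1(l)^{\mathsf T}=A(\mathbb{1}\otimes S_1(l))A^\dagger$ with $S_1(l)=e^{-iJ\tau(l)Y}$, the single-qubit gate $S_1(l)$ by the two-qubit gate $\widetilde S_1(l)$ acting on qubit $m$ and $\mathrm a$; that is, $$\left(R(B,J)^{\mathsf T}|\Phi\rangle\right)\otimes|+\rangle_{\mathrm a}=\widetilde V_0\widetilde V_1\cdots\widetilde V_L\,\left(|\Phi\rangle\otimes|+\rangle_{\mathrm a}\right),$$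 $$\widetilde V_l=(A\otimes \mathbb{1}_{\mathrm a})\,(\mathbb{1}\otimes\widetilde S_1(l))\,(A^\dagger\otimes \mathbb{1}_{\mathrm a})\,(\mathbb{1}\otimes S_0\otimes \mathbb{1}_{\mathrm a}).$$ The coupling $J$ enters only through the two-qubit Ising evolution $e^{-iJ\tau(l)X\otimes X}$ (Ising interaction at zero magnetic field for a time $\tau(l)$) on qubit $m$ and the auxiliary qubit. Measuring $Y_m$ at the end then yields the expectation value in (1). (3) $A$ is a product of $m$ (multiply) controlled-$X$ gates and a single $X$ gate, and can be implemented with $\mathcal{O}(m^2)$ elementary gates. Hence the circuit uses $m+2$ qubits, each of its $L+1$ steps uses $\mathcal{O}(m^2)$ elementary gates not involving $J$ and one two-qubit Ising evolution of duration $\tau(l)$, and the total time for which the Ising interaction is used is $\sum_{l=0}^{L}\tau(l)=T$.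
   Context: $N$-qubit side. Qubits are numbered $0,\dots,N-1$; $X_j,Y_j,Z_j$ are the Pauli matrices on qubit $j$. Put $H_0=\sum_{j=0}^{N-1}Z_j$ and $H_1=\sum_{j=0}^{N-1}X_jX_{j+1}$ with $X_N:=\widetilde ZX_0$, $\widetilde Z=\bigotimes_{j=0}^{N-1}Z_j$. Set $U_0=e^{iB\Delta H_0}$, $U_1(l)=e^{iJ\frac{l}{L}\Delta H_1}$ and $U(B,J)=\prod_{l=0}^{L}U_0U_1(l)$, where the factor $l=0$ acts first (is rightmost). Majorana operators: $x_{2j}=Z_0\cdots Z_{j-1}X_j$, $x_{2j+1}=Z_0\cdots Z_{j-1}Y_j$. Fermionic operators: $c_j=\frac12(x_{2j}+ix_{2j+1})$, and $b_1=\frac1{\sqrt N}\sum_{k=0}^{N-1}e^{-2\pi i k/N}c_k$. Compressed side. $\mathbb{C}^{2N}$ is identified with $m+1$ qubits numbered $0,\dots,m$. Its computational basis states are written $|j\rangle$, $0\le j\le 2N-1$, with qubit $m$ the last (least significant) one; $Y_m$ is the Pauli $Y$ on qubit $m$. Define - $|\Phi\rangle=\bigotimes_{l=0}^{m-1}\left(\frac{|0\rangle+e^{i2\pi 2^{l-m}}|1\rangle}{\sqrt2}\right)\otimes|+_y\rangle$, with $|+_y\rangle=\frac{1}{\sqrt2}(|0\rangle+i|1\rangle)$ on qubit $m$; - $A=\sum_{j=0}^{2N-2}|j+1\rangle\langle j|+|0\rangle\langle 2N-1|$; - $h_0=-\frac i2(\mathbb{1}\otimes Y_m)$, $h_1=Ah_0A^\dagger$,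 $R_0=e^{-4B\Delta h_0}$, $R_1(l)=e^{-4J\frac lL\Delta h_1}$, and $R(B,J)=\prod_{l=0}^{L}R_0R_1(l)$ (factor $l=0$ rightmost), a real orthogonal matrix; - $\tau(l)=2l\Delta/L$ and $S_0=e^{-2iB\Delta Y}$ (acting on qubit $m$); - $\widetilde S_1(l)=(\widetilde H\otimes\mathbb{1}_{\mathrm a})\,e^{-iJ\tau(l)X\otimes X_{\mathrm a}}\,(\widetilde H\otimes\mathbb{1}_{\mathrm a})$ acting on qubit $m$ and the auxiliary qubit $\mathrm a$, with $\widetilde H=\frac1{\sqrt2}(X+Y)$; - $|+\rangle=\frac1{\sqrt2}(|0\rangle+|1\rangle)$. $M^{\mathsf T}$ denotes the transpose in the computational basis, and $\mathbb{1}_{\mathrm a}$ the identity on the auxiliary qubit.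
   Formalization: In (1), and the closing sentence of (2), the right side is corrected to 1/2 − 1/2⟨Φ|R Y_m R^T|Φ⟩; as printed it fails at B=J=0 (0 versus −1/2). Qubit l<m is read as the binary digit of weight 2^l of k in |2k+s⟩. *)

(* Defs.v *)
From mathcomp Require Import all_boot all_order all_algebra.
From mathcomp Require Import all_classical all_reals all_analysis.
From mathcomp Require Import complex mxtens.

Set Implicit Arguments.
Unset Strict Implicit.
Unset Printing Implicit Defensive.

Import Order.TTheory GRing.Theory Num.Theory.
Import numFieldNormedType.Exports.

Local Open Scope classical_set_scope.
Local Open Scope complex_scope.
Local Open Scope ring_scope.
Local Open Scope sesquilinear_scope.

Section Generalities.
Variable R : realType.
Local Notation C := R[i].

(* The limit is taken in the normed space of complex matrices. *)
Definition expmx n (M : 'M[C]_n) : 'M[C]_n :=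
  lim (series (fun k => (k`!%:R)^-1 *: M ^+ k) @ \oo).

Definition expi (x : R) : C := cos x +i* sin x.

Definition expect d (psi : 'cV[C]_d) (M : 'M[C]_d) : C :=
  (psi ^t* *m M *m psi) 0 0.

Definition PX : 'M[C]_2 := \matrix_(a, b) (a != b)%:R.
Definition PY : 'M[C]_2 :=
  \matrix_(a, b) (if a == b then 0 else if a == 0 then - 'i else 'i).
Definition PZ : 'M[C]_2 :=
  \matrix_(a, b) (if a == b then (-1) ^+ (a : nat) else 0).

Definition ket2 (x y : C) : 'cV[C]_2 := \col_a (if a == 0 then x else y).

(* Basis states of an n-qubit register are the integers 0 <= k < d = 2 ^ n
   (d is a separate parameter so that products such as 2 ^ m * 2 are allowed),
   and "wire q" is the binary digit of weight 2 ^ q. *)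
Definition qbit (q k : nat) : bool := odd (k %/ 2 ^ q).

(* G on wire q and the identity on all the other wires. *)
Definition gate1 d (q : nat) (G : 'M[C]_2) : 'M[C]_d :=
  \matrix_(i, j)
    if (i %/ 2 ^ q.+1 == j %/ 2 ^ q.+1)%N && (i %% 2 ^ q == j %% 2 ^ q)%N
    then G (inord (qbit q i)) (inord (qbit q j)) else 0.

(* X on the wire t, controlled by the wires of cs; plain X if cs is empty.
   Only meaningful for t \notin cs. *)
Definition mcX d n (cs : {set 'I_n}) (t : 'I_n) : 'M[C]_d :=
  \matrix_(i, j)
    if [forall c in cs, qbit c j] then gate1 d t PX i j else (i == j)%:R.

(* Elementary gates: arbitrary one-qubit unitaries and CNOTs. *)
Definition elementary d n (G : 'M[C]_d) : Prop :=
  (exists (q : 'I_n) (u : 'M[C]_2), u \is unitarymx /\ G = gate1 d q u)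
  \/ (exists c t : 'I_n, c != t /\ G = mcX d [set c] t).

Definition elementary_circuit d n (s : seq 'M[C]_d) : Prop :=
  forall G, G \in s -> elementary n G.

End Generalities.

Arguments PX {R}.
Arguments PY {R}.
Arguments PZ {R}.

Definition Delta (R : realType) (L : nat) (T : R) : R := T / L.+1%:R.

Section Spins.
Variables (R : realType) (N : nat).
Local Notation C := R[i].
Local Notation op := 'M[C]_(2 ^ N).

Definition Xq (j : nat) : op := gate1 (2 ^ N) j PX.
Definition Yq (j : nat) : op := gate1 (2 ^ N) j PY.
Definition Zq (j : nat) : op := gate1 (2 ^ N) j PZ.

Definition Zall : op := \prod_(j < N) Zq j.
Definition Xper (j : nat) : op := if j == N then Zall *m Xq 0 else Xq j.

Definition H0 : op := \sum_(j < N) Zq j.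
Definition H1 : op := \sum_(j < N) (Xper j *m Xper j.+1).

Definition Zstring (j : nat) : op := \prod_(k < j) Zq k.
Definition majorana (a : nat) : op :=
  Zstring a./2 *m (if odd a then Yq a./2 else Xq a./2).
Definition cferm (j : nat) : op :=
  2%:R^-1 *: (majorana j.*2 + 'i *: majorana j.*2.+1).
Definition bferm1 : op :=
  (sqrtC N%:R)^-1 *:
    \sum_(k < N) (expi (- (2%:R * pi * k%:R / N%:R)) *: cferm k).
(* Its vacuum expectation is 0, whereas <Phi|Y_m|Phi> = 1 below: this is where
   the constant of <Bobs> = 1/2 - <Y_m>/2 comes from. *)
Definition Bobs : op := bferm1 ^t* *m bferm1.

Definition ket0 : 'cV[C]_(2 ^ N) := \col_k ((k : nat) == 0%N)%:R.

Variables (L : nat) (T B J : R).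

Definition U0 : op := expmx (('i * (B * Delta L T)%:C) *: H0).
Definition U1 (l : nat) : op :=
  expmx (('i * (J * (l%:R / L%:R) * Delta L T)%:C) *: H1).
(* The factor l = 0 is the rightmost one. *)
Definition Uevol : op := \prod_(l < L.+1) (U0 *m U1 (rev_ord l)).

End Spins.

(* C^{2N} is C^{2^m} (x) C^2, the basis state |2 k + s> being |k> (x) |s>, with
   s the state of qubit m; wire 0 is qubit m.  The auxiliary qubit is a further
   tensor factor C^2 on the right, so that with it wire 0 is the auxiliary
   qubit and wire 1 is qubit m. *)
Section Compressed.
Variables (R : realType) (m : nat).
Local Notation C := R[i].
Local Notation op := 'M[C]_(2 ^ m * 2).
Local Notation opa := 'M[C]_(2 ^ m * 2 * 2).

(* The tensor product of the states of the qubits l < m, where qubit l is the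
   binary digit of weight 2 ^ l of k. *)
Definition phase_state : 'cV[C]_(2 ^ m) :=
  \col_k \prod_(l < m)
    ((if qbit l k then expi (2%:R * pi * (2 ^+ l / 2 ^+ m)) else 1) / sqrtC 2%:R).
Definition plus_y : 'cV[C]_2 := ket2 (sqrtC 2%:R)^-1 ('i / sqrtC 2%:R).
Definition plus : 'cV[C]_2 := ket2 (sqrtC 2%:R)^-1 (sqrtC 2%:R)^-1.
Definition Phi : 'cV[C]_(2 ^ m * 2) := phase_state *t plus_y.

Definition on_last (G : 'M[C]_2) : op := 1%:M *t G.
Definition Ym : op := on_last PY.

Definition A : op := \sum_j delta_mx (ordS j) j.
Definition h0 : op := (- 'i / 2%:R) *: Ym.
Definition h1 : op := A *m h0 *m A ^t*.

(* G acting on qubit m (first factor) and on the auxiliary qubit. *)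
Definition on_last_aux (G : 'M[C]_(2 * 2)) : opa :=
  castmx (mulnA _ _ _, mulnA _ _ _) (1%:M *t G).
Definition with_aux (M : op) : opa := M *t 1%:M.

(* Two-qubit Ising evolution at zero field, coupling J, during a time t. *)
Definition ising (J t : R) : 'M[C]_(2 * 2) :=
  expmx ((- 'i * (J * t)%:C) *: (PX *t PX)).
Definition Htilde : 'M[C]_2 := (sqrtC 2%:R)^-1 *: (PX + PY).

Variables (L : nat) (T B J : R).

Definition R0 : op := expmx ((- (4%:R * B * Delta L T))%:C *: h0).
Definition R1 (l : nat) : op :=
  expmx ((- (4%:R * J * (l%:R / L%:R) * Delta L T))%:C *: h1).
(* The factor l = 0 is the rightmost one. *)
Definition Rot : op := \prod_(l < L.+1) (R0 *m R1 (rev_ord l)).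

Definition tau (l : nat) : R := 2%:R * l%:R * Delta L T / L%:R.
Definition S0 : 'M[C]_2 := expmx ((- 'i * (2%:R * B * Delta L T)%:C) *: PY).
Definition S1 (l : nat) : 'M[C]_2 := expmx ((- 'i * (J * tau l)%:C) *: PY).
Definition S1tilde (l : nat) : 'M[C]_(2 * 2) :=
  (Htilde *t 1%:M) *m ising J (tau l) *m (Htilde *t 1%:M).
Definition Vtilde (l : nat) : opa :=
  with_aux A *m on_last_aux (S1tilde l) *m with_aux (A ^t*)
  *m with_aux (on_last S0).
Definition psi_out : 'cV[C]_(2 ^ m * 2 * 2) :=
  (\prod_(l < L.+1) Vtilde l) *m (Phi *t plus).

End Compressed.

(* Main.v *)
(** In terms of the Majorana operators x_a, a < 2N, both H_0 and H_1 are sums of operators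
    - i x_a x_b over disjoint pairs; the second pairing is the first one moved by the cyclic shift A
    (the string of Z's in X_N makes the last pair fit the pattern).  Hence U^* x_a U = sum_b R_ab x_b,
    and <0|x_a x_b|0> = (1 - Y_m)_ab turns the expectation value into 1/2 - w^* Y_m w, where
    w = R^T v and v holds the coefficients of b_1.  Up to the factor 1/sqrt 2, v is the mode of
    momentum -1 with internal state |+_y>, while Phi is that of momentum +1.  Both give the same
    value: R^T is real and commutes with the shift by two sites, so it acts on a momentum mode by a
    unitary q of C^2, and q^* Y q is hermitian and traceless.

    The O(m^2) circuit for A does not decompose the multiply controlled gates.  Instead the
    increment is diagonalized wire by wire by Hadamard gates and controlled phases, as in the
    quantum Fourier transform, and its eigenvalue matrix is a product of one-qubit phases. *)

Require Import Defs.
From mathcomp Require Import all_boot all_order all_algebra.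
From mathcomp Require Import all_classical all_reals all_analysis.
From mathcomp Require Import complex mxtens.
From mathcomp Require Import ring zify.
Set Implicit Arguments.
Unset Strict Implicit.
Unset Printing Implicit Defensive.
Import Order.TTheory GRing.Theory Num.Theory.
Import numFieldNormedType.Exports.
Local Open Scope complex_scope.
Local Open Scope ring_scope.
Local Open Scope sesquilinear_scope.

(** * Exponentials of sums of commuting involutions *)

(** The exponentials are limits of matrix series, yet no estimate on matrices is needed. Each
    exponent is a multiple of a sum of commuting involutions; the identity resolves into
    eigen-operators of that sum, and the series splits into scalar ones. Every evolution thus
    becomes a product of factors cos t + i sin t P. Conjugation applies such a factor on both sides
    and doubles the angle, which together with the 1/2 in h_0 is the origin of the 4 in R_0 and R_1.
    In the circuit for A, the increment of the wires from l up is X on wire l after an increment of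
    the upper wires controlled by l, that is, X diag(1, V). Conjugation by diag(1, V^{-1/2}) turns
    it into X ⊗ V^{1/2}, so diagonalizing V diagonalizes the whole, with the angles halved. Once V
    is diagonal this conjugation is one controlled phase per upper wire: O(m) gates for each of O(m)
    wires. *)

Section Exponential.
Variable R : realType.
Local Notation C := R[i].
Local Open Scope classical_set_scope.

Lemma complexRE (z : C) : z = (complex.Re z)%:C + 'i * (complex.Im z)%:C.
Proof. exact: complexE. Qed.

Lemma conj_real (x : R) : (x%:C)^* = x%:C :> C.
Proof. exact: conjc_real. Qed.

Lemma real_complexD (x y : R) : (x + y)%:C = x%:C + y%:C.
Proof. exact: rmorphD. Qed.

Lemma real_complexB (x y : R) : (x - y)%:C = x%:C - y%:C.
Proof. exact: rmorphB. Qed.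

Lemma real_complexM (x y : R) : (x * y)%:C = x%:C * y%:C.
Proof. exact: rmorphM. Qed.

Lemma expi0 : expi (0 : R) = 1.
Proof. by rewrite /expi cos0 sin0. Qed.

Lemma expiD (x y : R) : expi (x + y) = expi x * expi y.
Proof.
rewrite /expi cosD sinD; apply/eqP.
by rewrite eq_complex /= eqxx /= addrC.
Qed.

Lemma expiE (x : R) : expi x = (cos x)%:C + 'i * (sin x)%:C.
Proof. exact: complexRE. Qed.

Lemma conj_expi (x : R) : (expi x)^* = expi (- x).
Proof. by rewrite /expi cosN sinN. Qed.

Lemma cvg_real_complex (T : Type) (F : set_system T) (FF : Filter F)
    (f : T -> R) (a : R) :
  f @ F --> a -> (fun t => (f t)%:C : C^o) @ F --> (a%:C : C^o).
Proof.
(* In the order of [C] a positive [e] is real, so its real part serves as the radius in [R]. *)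
move=> fa; apply/cvgrPdist_lt => e; rewrite ltcE => /andP[/eqP/= e2 e1].
move/cvgrPdist_lt: fa => /(_ _ e1); apply: filterS => t /=.
rewrite -rmorphB /= normc_def /= expr0n /= addr0 sqrtr_sqr.
by rewrite ltcE /= e2 eqxx.
Qed.

Lemma exp_term_expi (x : R) (k : nat) :
  (k`!%:R)^-1 * ('i * x%:C) ^+ k = (cos_coeff x k)%:C + 'i * (sin_coeff x k)%:C :> C.
Proof.
have h2 j : ('i : C) ^+ j.*2 = (-1) ^+ j by rewrite -mul2n exprM sqrCi.
rewrite exprMn.
have -> : ('i : C) ^+ k = (if odd k then 'i else 1) * (-1) ^+ k./2.
  by rewrite -[in LHS](odd_double_half k) exprD h2; case: (odd k); rewrite ?expr1.
have -> : cos_coeff x k = (~~ odd k)%:R * (-1) ^+ k./2 * x ^+ k / k`!%:R by [].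
have -> : sin_coeff x k = (odd k)%:R * (-1) ^+ k.-1./2 * x ^+ k / k`!%:R by [].
rewrite mulrC !(rmorphM, rmorphXn, fmorphV, rmorph_nat, rmorphN, rmorph1) /=.
case ok: (odd k) => /=; last by rewrite !(mul0r, mulr0, mul1r, addr0).
case: k ok h2 => // k /= /negbTE ok _; rewrite uphalf_half ok.
by rewrite !(mul0r, mulr0, mul1r, add0r) !mulrA.
Qed.

Lemma cvg_series_expi (x : R) :
  series (fun k => (k`!%:R)^-1 * ('i * x%:C) ^+ k : C^o) @ \oo --> (expi x : C^o).
Proof.
have -> : series (fun k => (k`!%:R)^-1 * ('i * x%:C) ^+ k : C^o)
   = (fun n => (series (cos_coeff x) n)%:C + 'i * (series (sin_coeff x) n)%:C).
  apply/funext => n; rewrite /series /= !rmorph_sum /= mulr_sumr -big_split.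
  by apply: eq_bigr => k _; rewrite exp_term_expi.
rewrite expiE; apply: cvgD.
  by apply: cvg_real_complex; rewrite cos.unlock; exact: is_cvg_series_cos_coeff.
apply: cvgM; first exact: cvg_cst.
by apply: cvg_real_complex; rewrite sin.unlock; exact: is_cvg_series_sin_coeff.
Qed.

(* Pairs (eigenvalue, operator) that resolve the identity; the operators need be neither
   orthogonal to each other nor hermitian. *)
Definition spectral n (H : 'M[C]_n) (s : seq (R * 'M[C]_n)) : Prop :=
  \sum_(p <- s) p.2 = 1 /\ forall p, p \in s -> H *m p.2 = p.1%:C *: p.2.

Definition spectral_exp n (s : seq (R * 'M[C]_n)) (t : R) : 'M[C]_n :=
  \sum_(p <- s) expi (t * p.1) *: p.2.

(** The operators of [s] sum to the identity, so H^k is the sum of the p.1^k p.2, and the matrix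
    series is a finite combination of scalar exponential series with constant matrix
    coefficients. *)
Lemma expmx_spectral n (H : 'M[C]_n) s (t : R) :
  spectral H s -> expmx (('i * t%:C) *: H) = spectral_exp s t.
Proof.
move=> [s1 sH]; apply: norm_cvg_lim.
have -> : series (fun k => (k`!%:R)^-1 *: (('i * t%:C) *: H) ^+ k : 'M[C]_n) =
  (fun N => \sum_(p <- s) series (fun k => (k`!%:R)^-1 * ('i * (t * p.1)%:C) ^+ k) N *: p.2).
  apply/funext => N; rewrite /series /=.
  under [RHS]eq_bigr do rewrite scaler_suml.
  rewrite exchange_big; apply: eq_bigr => k _.
  rewrite -[in LHS](mulr1 (_ ^+ k)) -s1 mulr_sumr scaler_sumr big_seq [RHS]big_seq.
  apply: eq_bigr => p ps; rewrite -[RHS]scalerA; congr (_ *: _).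
  elim: k => [|k IH]; first by rewrite !expr0 scale1r [LHS]mul1mx.
  rewrite exprS -mulrA IH exprSr -[RHS]scalerA -[LHS]scalemxAr; congr (_ *: _).
  by rewrite -[LHS]scalemxAl sH // scalerA rmorphM mulrA.
rewrite /spectral_exp; elim: s {s1 sH} => [|p s IH].
  by rewrite big_nil; under eq_fun do rewrite big_nil; exact: cvg_cst.
rewrite big_cons; under eq_fun do rewrite big_cons.
by apply: cvgD IH; apply: cvgZr_tmp; exact: cvg_series_expi.
Qed.

Lemma sum_cat_map2 (V : nmodType) (I K : Type) (s : seq I) (f g : I -> K) (F : K -> V) :
  \sum_(p <- [seq f p | p <- s] ++ [seq g p | p <- s]) F p = \sum_(p <- s) (F (f p) + F (g p)).
Proof. by rewrite big_cat !big_map /= -big_split. Qed.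

Lemma half_sum_diff (F : numFieldType) (a b : F) : (a + b) * 2^-1 + (a - b) * 2^-1 = a.
Proof. by field. Qed.

Lemma half_diff_sum (F : numFieldType) (a b : F) : (a + b) * 2^-1 - (a - b) * 2^-1 = b.
Proof. by field. Qed.

Lemma mul_invol_alg n (F : comPzRingType) (P : 'M[F]_n) (a b c d : F) : P *m P = 1%:M ->
  (a%:M + b *: P) *m (c%:M + d *: P) = (a * c + b * d)%:M + (a * d + b * c) *: P.
Proof.
move=> PP; rewrite mulmxDl !mulmxDr -scalar_mxM mul_mx_scalar mul_scalar_mx.
rewrite -scalemxAl -scalemxAr PP !scalerA scalemx1 !scalerDl raddfD /= (mulrC c).
by rewrite -!addrA; congr (_ + _); rewrite addrA addrC.
Qed.

(** For an involution [P] this is e^{itP}. *)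
Definition rotmx n (t : R) (P : 'M[C]_n) : 'M[C]_n := (cos t)%:C%:M + ('i * (sin t)%:C) *: P.

(** [E 1] and [E (-1)] are the projections (1 + P)/2 and (1 - P)/2 on the eigenspaces of [P], and
    they commute with [H]. Cutting every member of [s] by both refines the resolution and shifts the
    eigenvalues by 1 or -1; the phases e^{it} and e^{-it} on the two halves recombine into
    [rotmx t P]. *)
Lemma spectral_add_invol n (H P : 'M[C]_n) s (t : R) :
  spectral H s -> P *m P = 1%:M -> H *m P = P *m H ->
  exists s', spectral (H + P) s' /\
    spectral_exp s' t = rotmx t P *m spectral_exp s t.
Proof.
move=> [s1 sH] PP HP.
pose E (e : R) : 'M[C]_n := 2^-1 *: (1%:M + e%:C *: P).
have PE e : e ^+ 2 = 1 -> P *m E e = e%:C *: E e.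
  move=> e2; rewrite /E -scalemxAr mulmxDr mulmx1 -scalemxAr PP scalerA mulrC -scalerA.
  by congr (_ *: _); rewrite scalerDr scalerA -rmorphM -expr2 e2 scale1r addrC.
have HE e : H *m E e = E e *m H.
  by rewrite /E -scalemxAr -scalemxAl mulmxDr mulmxDl mulmx1 mul1mx -scalemxAr -scalemxAl HP.
have E1 : E 1 + E (-1) = 1%:M.
  rewrite /E -scalerDr rmorphN rmorph1 scale1r scaleN1r addrACA subrr addr0.
  by rewrite -mulr2n -(scaler_nat 2 (1%:M : 'M[C]_n)) scalerA mulVf ?scale1r // pnatr_eq0.
pose f (e : R) (p : R * 'M[C]_n) := (p.1 + e, E e *m p.2).
exists ([seq f 1 p | p <- s] ++ [seq f (-1) p | p <- s]); split; first split.
- rewrite sum_cat_map2 -[RHS]s1; apply: eq_bigr => p _ /=.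
  by rewrite -mulmxDl E1 mul1mx.
- have key e p : e ^+ 2 = 1 -> p \in s -> (H + P) *m (f e p).2 = ((f e p).1)%:C *: (f e p).2.
    move=> e2 ps; rewrite /= mulmxDl !mulmxA HE PE // -!mulmxA sH //.
    by rewrite -scalemxAr -scalemxAl rmorphD scalerDl.
  by move=> p; rewrite mem_cat => /orP[] /mapP[q qs ->]; apply: key; rewrite ?sqrrN ?expr1n.
- rewrite /spectral_exp sum_cat_map2 mulmx_sumr.
  apply: eq_bigr => p _ /=; rewrite !mulrDr !expiD mulr1 mulrN1 -!scalerA.
  rewrite -scalerDr -scalemxAr; congr (_ *: _).
  rewrite !scalemxAl -mulmxDl; congr (_ *m _).
  rewrite /E !scalerA !expiE cosN sinN !rmorphN rmorph1 scale1r scaleN1r mulrN.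
  rewrite !scalerDr !scalerN addrACA -scalerDl -scalerBl /rotmx -[in RHS]scalemx1.
  by congr (_ *: _ + _ *: _); rewrite ?half_sum_diff ?half_diff_sum.
Qed.

Lemma spectral_sum_invol n (I : eqType) (r : seq I) (P : I -> 'M[C]_n) (t : R) :
  (forall i, i \in r -> P i *m P i = 1%:M) ->
  (forall i j, i \in r -> j \in r -> P i *m P j = P j *m P i) ->
  exists s, spectral (\sum_(i <- r) P i) s /\
    spectral_exp s t = \prod_(i <- r) rotmx t (P i).
Proof.
elim: r => [_ _|i r IH PP Pc].
  exists [:: (0, 1%:M)]; rewrite !big_nil; split; first split.
  - by rewrite big_seq1.
  - by move=> p; rewrite inE => /eqP ->; rewrite /= mul0mx scale0r.
  - by rewrite /spectral_exp big_seq1 mulr0 expi0 scale1r.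
have [||s [Hs es]] := IH.
- by move=> j jr; apply: PP; rewrite inE jr orbT.
- by move=> j k jr kr; apply: Pc; rewrite inE ?jr ?kr orbT.
have iir : i \in i :: r by rewrite mem_head.
have [|s' [Hs' es']] := spectral_add_invol t Hs (PP i iir).
  rewrite mulmx_suml mulmx_sumr big_seq [RHS]big_seq; apply: eq_bigr => j jr.
  by apply: Pc => //; rewrite inE jr orbT.
by exists s'; rewrite !big_cons addrC; split=> //; rewrite es' es.
Qed.

Lemma expmx_sum_invol n (I : eqType) (r : seq I) (P : I -> 'M[C]_n) (t : R) :
  (forall i, i \in r -> P i *m P i = 1%:M) ->
  (forall i j, i \in r -> j \in r -> P i *m P j = P j *m P i) ->
  expmx (('i * t%:C) *: \sum_(i <- r) P i) = \prod_(i <- r) rotmx t (P i).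
Proof.
by move=> PP Pc; have [s [/expmx_spectral-> ->]] := spectral_sum_invol t PP Pc.
Qed.

Lemma expmx_invol n (P : 'M[C]_n) (t : R) :
  P *m P = 1%:M -> expmx (('i * t%:C) *: P) = rotmx t P.
Proof.
move=> PP; have := @expmx_sum_invol n unit [:: tt] (fun=> P) t.
by rewrite !big_seq1; apply.
Qed.

Lemma conj_rotmx n (t : R) (P : 'M[C]_n) : P ^t* = P -> (rotmx t P) ^t* = rotmx (- t) P.
Proof.
move=> Ph; rewrite /rotmx linearD /= tr_scalar_mx linearZ /= map_mxD map_scalar_mx map_mxZ Ph.
by rewrite /= rmorphM /= !conj_real conjCi cosN sinN rmorphN mulNr mulrN.
Qed.

Lemma rotmxD n (t u : R) (P : 'M[C]_n) : P *m P = 1%:M ->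
  rotmx t P *m rotmx u P = rotmx (t + u) P.
Proof.
move=> PP; rewrite [LHS](mul_invol_alg _ _ _ _ PP) /rotmx cosD sinD mulrACA -expr2 sqrCi mulN1r.
rewrite real_complexB real_complexD !real_complexM; congr (_%:M + _ *: _).
by rewrite mulrDr [LHS]addrC; congr (_ + _); [rewrite mulrA | rewrite mulrCA].
Qed.

Lemma rotmx0 n (P : 'M[C]_n) : rotmx 0 P = 1%:M.
Proof. by rewrite /rotmx cos0 sin0 mulr0 scale0r addr0. Qed.

Lemma rotmx_unitary n (t : R) (P : 'M[C]_n) : P ^t* = P -> P *m P = 1%:M ->
  rotmx t P \is unitarymx.
Proof. by move=> Ph PP; apply/unitarymxP; rewrite conj_rotmx // rotmxD // subrr rotmx0. Qed.

Lemma rotmx_conj n m (t : R) (P : 'M[C]_n) (V : 'M[C]_(m, n)) (W : 'M[C]_(n, m)) :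
  V *m W = 1%:M -> rotmx t (V *m P *m W) = V *m rotmx t P *m W.
Proof.
move=> VW; rewrite /rotmx mulmxDr mulmxDl mul_mx_scalar -!scalemxAl -scalemxAr VW.
by rewrite scalemx1 -scalemxAl.
Qed.

Lemma tr_rotmx n (t : R) (P : 'M[C]_n) : (rotmx t P)^T = rotmx t P^T.
Proof. by rewrite /rotmx linearD /= tr_scalar_mx linearZ. Qed.

Lemma rotmxN n (t : R) (P : 'M[C]_n) : rotmx t (- P) = rotmx (- t) P.
Proof. by rewrite /rotmx cosN sinN rmorphN mulrN scalerN scaleNr. Qed.

End Exponential.

(** * One-qubit gates on a register *)

Section Bits.

Lemma pow2_gt0 n : (0 < 2 ^ n)%N.
Proof. by rewrite expn_gt0. Qed.

Lemma qbit0 k : qbit 0 k = odd k.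
Proof. by rewrite /qbit expn0 divn1. Qed.

Lemma qbitS q k : qbit q.+1 k = qbit q k./2.
Proof. by rewrite /qbit expnS divnMA divn2. Qed.

Lemma qbit_div p q k : qbit p (k %/ 2 ^ q) = qbit (q + p) k.
Proof. by rewrite /qbit -divnMA -expnD. Qed.

Lemma qbit_mod p q k : (p < q)%N -> qbit p (k %% 2 ^ q) = qbit p k.
Proof.
move=> pq; rewrite /qbit [in RHS](divn_eq k (2 ^ q)).
have -> : (2 ^ q = 2 ^ (q - p.+1) * 2 * 2 ^ p)%N.
  by rewrite -mulnA -expnS -expnD subnK.
by rewrite mulnA divnMDl ?pow2_gt0 // oddD !oddM /= !andbF addFb.

Qed.

Lemma qbit_ext n k k' : (k < 2 ^ n)%N -> (k' < 2 ^ n)%N ->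
  (forall q, (q < n)%N -> qbit q k = qbit q k') -> k = k'.
Proof.
elim: n k k' => [|n IH] k k'; first by rewrite expn0 !ltnS !leqn0 => /eqP-> /eqP->.
rewrite expnS => kn kn' kk.
rewrite -(odd_double_half k) -(odd_double_half k') -!qbit0 kk //.
by rewrite (IH k./2 k'./2) // -?divn2 ?ltn_divLR // 1?mulnC // => q qn; rewrite !divn2 -!qbitS kk.
Qed.

Definition setbit (q : nat) (b : bool) (k : nat) : nat :=
  ((k %/ 2 ^ q.+1 * 2 + b) * 2 ^ q + k %% 2 ^ q)%N.

Lemma setbit_div q b k : (setbit q b k %/ 2 ^ q = k %/ 2 ^ q.+1 * 2 + b)%N.
Proof. by rewrite /setbit divnMDl ?pow2_gt0 // [(k %% _ %/ _)%N]divn_small ?addn0 // ltn_mod pow2_gt0. Qed.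

Lemma setbit_divS q b k : (setbit q b k %/ 2 ^ q.+1 = k %/ 2 ^ q.+1)%N.
Proof.
rewrite [in LHS]expnSr divnMA setbit_div divnMDl // [X in (_ + X)%N]divn_small ?addn0 //.
by case: b.
Qed.

Lemma setbit_mod q b k : (setbit q b k %% 2 ^ q = k %% 2 ^ q)%N.
Proof. by rewrite /setbit modnMDl modn_mod. Qed.

Lemma qbit_setbit q b k : qbit q (setbit q b k) = b.
Proof. by rewrite /qbit setbit_div oddD oddM andbF; case: b. Qed.

Lemma qbit_setbit_neq p q b k : p != q -> qbit p (setbit q b k) = qbit p k.
Proof.
rewrite neq_ltn => /orP[pq|qp].
  by rewrite -(qbit_mod _ pq) setbit_mod qbit_mod.
by rewrite -(subnKC qp) -!qbit_div setbit_divS.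
Qed.

Lemma setbit_lt n q b k : (q < n)%N -> (k < 2 ^ n)%N -> (setbit q b k < 2 ^ n)%N.
Proof.
move=> qn kn.
have e : (2 ^ n = 2 ^ (n - q.+1) * 2 ^ q.+1)%N by rewrite -expnD subnK.
by rewrite e -ltn_divLR ?pow2_gt0 // setbit_divS ltn_divLR ?pow2_gt0 // -e.
Qed.

(** The test in [gate1], equal digits above and below wire [q], means that [k'] is [k] with digit
    [q] overwritten. *)
Lemma setbit_same q k k' : (k %/ 2 ^ q.+1 == k' %/ 2 ^ q.+1)%N && (k %% 2 ^ q == k' %% 2 ^ q)%N ->
  k' = setbit q (qbit q k') k.
Proof.
case/andP=> /eqP e /eqP f; rewrite /setbit e f expnSr divnMA /qbit.
by rewrite -modn2 -divn_eq -divn_eq.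
Qed.

Lemma setbit_id q k : setbit q (qbit q k) k = k.
Proof. by rewrite -setbit_same // !eqxx. Qed.

Lemma setbitK q b c k : setbit q b (setbit q c k) = setbit q b k.
Proof. by rewrite {1}/setbit setbit_divS setbit_mod. Qed.

Lemma setbitC n p q b c k : (p < n)%N -> (q < n)%N -> (k < 2 ^ n)%N -> p != q ->
  setbit p b (setbit q c k) = setbit q c (setbit p b k).
Proof.
move=> pn qn kn pq; apply: (@qbit_ext n); rewrite ?setbit_lt // => r rn.
have [->|rp] := eqVneq r p; first by rewrite qbit_setbit qbit_setbit_neq // qbit_setbit.
have [->|rq] := eqVneq r q; last by rewrite !qbit_setbit_neq.
by rewrite qbit_setbit qbit_setbit_neq 1?eq_sym // qbit_setbit.
Qed.

End Bits.

Section Gates.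
Variables (R : realType) (d n : nat).
Hypothesis dn : d = (2 ^ n)%N.
Local Notation C := R[i].
Local Notation gate1 := (@gate1 R d).

(** For [q < n] the overwritten index stays in range and the default [i] is not taken, see
    [setordE]. *)
Definition setord (q : nat) (b : 'I_2) (i : 'I_d) : 'I_d := insubd i (setbit q (b != 0) i).

Definition qord (q : nat) (i : nat) : 'I_2 := inord (qbit q i).

Lemma qordE q i : (qord q i != 0) = qbit q i.
Proof. by rewrite /qord -val_eqE /= inordK; case: qbit. Qed.

Lemma inord_neq0 (b : 'I_2) : inord (b != 0) = b.
Proof. by apply: val_inj; rewrite /= inordK; case: b => [[|[|]]]. Qed.

Lemma setordE q b i : (q < n)%N -> setord q b i = setbit q (b != 0) i :> nat.
Proof.
move=> qn; rewrite /setord val_insubd ifT //; have := ltn_ord i.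
by rewrite [X in (_ < X)%N -> _]dn [X in _ -> (_ < X)%N]dn; exact: setbit_lt.
Qed.

Lemma qord_setord q b i : (q < n)%N -> qord q (setord q b i) = b.
Proof. by move=> qn; rewrite /qord setordE // qbit_setbit inord_neq0. Qed.

Lemma qord_setord_neq p q b i : (q < n)%N -> p != q -> qord p (setord q b i) = qord p i.
Proof. by move=> qn pq; rewrite /qord setordE // qbit_setbit_neq. Qed.

Lemma setordK q b c i : (q < n)%N -> setord q b (setord q c i) = setord q b i.
Proof. by move=> qn; apply: val_inj; rewrite /= !setordE // setbitK. Qed.

Lemma setord_id q (i : 'I_d) : (q < n)%N -> setord q (qord q i) i = i.
Proof. by move=> qn; apply: val_inj; rewrite /= setordE // qordE setbit_id. Qed.

Lemma setordC p q b c i : (p < n)%N -> (q < n)%N -> p != q ->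
  setord p b (setord q c i) = setord q c (setord p b i).
Proof.
move=> pn qn pq; apply: val_inj; rewrite /= !setordE //; apply: (@setbitC n) => //.
by rewrite -dn.
Qed.

(** Summing over the new digit [b] of wire [q], instead of testing which digits agree, reduces
    products of gates to sums over two values: composition on one wire becomes [setordK],
    commutation on two wires [setordC]. *)
Lemma gate1E q (G : 'M[C]_2) (i j : 'I_d) : (q < n)%N ->
  gate1 q G i j = \sum_(b < 2) G (qord q i) b * (setord q b i == j)%:R.
Proof.
move=> qn; rewrite mxE; case: ifP => [same|nsame].
  have e := setbit_same same.
  rewrite (bigD1 (qord q j)) //= big1 ?addr0.
    by rewrite (_ : _ == j) ?mulr1 // -val_eqE /= setordE // qordE -e.
  move=> b bj; rewrite (negbTE (_ : setord q b i != j)) ?mulr0 //.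
  by apply: contra bj => /eqP <-; rewrite qord_setord.
rewrite big1 // => b _; case: eqP => [ej|_]; last by rewrite mulr0.
by move: nsame; rewrite -ej setordE // setbit_divS setbit_mod !eqxx.
Qed.

Lemma mul_gate1 m q (G : 'M[C]_2) (M : 'M[C]_(d, m)) i j : (q < n)%N ->
  (gate1 q G *m M) i j = \sum_(b < 2) G (qord q i) b * M (setord q b i) j.
Proof.
move=> qn; rewrite mxE; under eq_bigr do rewrite gate1E // mulr_suml.
rewrite exchange_big; apply: eq_bigr => b _.
rewrite (bigD1 (setord q b i)) //= eqxx mulr1 big1 ?addr0 // => k.
by rewrite eq_sym => /negbTE ->; rewrite mulr0 mul0r.
Qed.

Lemma gate1M q (G H : 'M[C]_2) : (q < n)%N -> gate1 q (G *m H) = gate1 q G *m gate1 q H.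
Proof.
move=> qn; apply/matrixP => i j; rewrite mul_gate1 // gate1E //.
under [RHS]eq_bigr do rewrite gate1E // qord_setord // mulr_sumr.
rewrite exchange_big; apply: eq_bigr => c _; rewrite mxE mulr_suml.
by apply: eq_bigr => b _; rewrite setordK // mulrA.
Qed.

Lemma gate1_1 q : (q < n)%N -> gate1 q 1%:M = 1%:M.
Proof.
move=> qn; apply/matrixP => i j; rewrite gate1E // (bigD1 (qord q i)) //= big1.
  by rewrite setord_id // !mxE eqxx mul1r addr0.
by move=> b bi; rewrite mxE eq_sym (negbTE bi) mul0r.
Qed.

Lemma gate1Z q (a : C) (G : 'M[C]_2) : gate1 q (a *: G) = a *: gate1 q G.
Proof. by apply/matrixP => i j; rewrite !mxE; case: ifP; rewrite ?mulr0. Qed.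

Lemma gate1_tC q (G : 'M[C]_2) : (gate1 q G) ^t* = gate1 q (G ^t*).
Proof.
apply/matrixP => i j; rewrite !mxE eq_sym [X in _ && X]eq_sym.
by case: ifP => _; rewrite ?mxE ?rmorph0.
Qed.

Lemma gate1_comm p q (G H : 'M[C]_2) : (p < n)%N -> (q < n)%N -> p != q ->
  gate1 p G *m gate1 q H = gate1 q H *m gate1 p G.
Proof.
move=> pn qn pq; apply/matrixP => i j; rewrite !mul_gate1 //.
under eq_bigr do rewrite gate1E // qord_setord_neq 1?eq_sym // mulr_sumr.
rewrite exchange_big; apply: eq_bigr => c _; rewrite gate1E // mulr_sumr.
rewrite qord_setord_neq //; apply: eq_bigr => b _.
by rewrite (@setordC p q) // mulrCA.
Qed.

Lemma gate1_unitary q (G : 'M[C]_2) : (q < n)%N -> G \is unitarymx -> gate1 q G \is unitarymx.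
Proof.
by move=> qn /unitarymxP G1; apply/unitarymxP; rewrite gate1_tC -gate1M // G1 gate1_1.
Qed.
End Gates.

(** * The increment of a register as a circuit *)

Section Increment.

Definition flip (t k : nat) : nat := setbit t (~~ qbit t k) k.

(** Adds 1 to the number written on the wires from [t] up. [t = 0] is the shift [A], [t = 1] is [A]
    beside an auxiliary wire 0, and [t = n] is the identity on the register. *)
Definition inc (n t k : nat) : nat := ((k + 2 ^ t) %% 2 ^ n)%N.

Lemma qbit_flip t k : qbit t (flip t k) = ~~ qbit t k.
Proof. by rewrite /flip qbit_setbit. Qed.

Lemma qbit_flip_neq p t k : p != t -> qbit p (flip t k) = qbit p k.
Proof. by move=> pt; rewrite /flip qbit_setbit_neq. Qed.

Lemma flipK t : involutive (flip t).
Proof. by move=> k; rewrite /flip qbit_setbit negbK setbitK setbit_id. Qed.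

Lemma flip_lt n t k : (t < n)%N -> (k < 2 ^ n)%N -> (flip t k < 2 ^ n)%N.
Proof. exact: setbit_lt. Qed.

Lemma inc_lt n t k : (inc n t k < 2 ^ n)%N.
Proof. by rewrite ltn_mod pow2_gt0. Qed.

Lemma setbit_MD t c x y : (y < 2 ^ t.+1)%N ->
  setbit t c (x * 2 ^ t.+1 + y) = (x * 2 ^ t.+1 + (c * 2 ^ t + y %% 2 ^ t))%N.
Proof.
move=> yt; rewrite /setbit divnMDl ?pow2_gt0 // (divn_small yt) addn0.
by rewrite expnS mulnA modnMDl mulnDl addnA.
Qed.

Lemma modn_MD h H d y : (y < d)%N -> ((h * d + y) %% (H * d) = h %% H * d + y)%N.
Proof.
move=> yd; have d0 : (0 < d)%N by apply: leq_ltn_trans yd.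
case: H => [|H]; first by rewrite mul0n !modn0.
rewrite {1}(divn_eq h H.+1) mulnDl -mulnA -addnA modnMDl modn_small //.
apply: (@leq_trans ((h %% H.+1).+1 * d)); first by rewrite mulSn addnC ltn_add2r.
by rewrite leq_mul2r ltn_mod orbT.
Qed.

Lemma bit_decomp t k :
  (k = k %/ 2 ^ t.+1 * 2 ^ t.+1 + (qbit t k * 2 ^ t + k %% 2 ^ t))%N.
Proof.
by rewrite -{1}(setbit_id t k) /setbit mulnDl -mulnA -expnS addnA.
Qed.

Lemma pow2_split n t : (t < n)%N -> (2 ^ n = 2 ^ (n - t.+1) * 2 ^ t.+1)%N.
Proof. by move=> tn; rewrite -expnD subnK. Qed.

Lemma flip_inc0 n t k : (t < n)%N -> (k < 2 ^ n)%N -> ~~ qbit t k -> flip t k = inc n t k.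
Proof.
move=> tn kn b0; rewrite /flip b0 /inc [in RHS](bit_decomp t k) (negbTE b0) mul0n add0n.
have rt : (k %% 2 ^ t < 2 ^ t)%N by rewrite ltn_mod pow2_gt0.
have rt2 : (2 ^ t + k %% 2 ^ t < 2 ^ t.+1)%N by rewrite expnS mul2n -addnn ltn_add2l.
rewrite -addnA [(_ %% _ + _)%N]addnC (pow2_split tn) modn_MD // modn_small.
  by rewrite /setbit mulnDl -mulnA -expnS mul1n addnA.
by rewrite ltn_divLR ?pow2_gt0 // -pow2_split.
Qed.

(** When digit [t] is 1, adding 2^t clears it and carries: add 2^(t+1), which keeps digit [t], then
    flip that digit. *)
Lemma flip_inc1 n t k : (t < n)%N -> qbit t k ->
  flip t (inc n t.+1 k) = inc n t k /\ qbit t (inc n t.+1 k).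
Proof.
move=> tn b1; rewrite /inc (bit_decomp t k) b1 mul1n.
set h := (k %/ _)%N; set r := (k %% 2 ^ t)%N.
have rt : (r < 2 ^ t)%N by rewrite ltn_mod pow2_gt0.
have rt2 : (2 ^ t + r < 2 ^ t.+1)%N by rewrite expnS mul2n -addnn ltn_add2l.
have rt3 : (r < 2 ^ t.+1)%N by apply: leq_trans rt _; rewrite leq_exp2l.
have -> : (h * 2 ^ t.+1 + (2 ^ t + r) + 2 ^ t.+1 = h.+1 * 2 ^ t.+1 + (2 ^ t + r))%N.
  by rewrite mulSn; lia.
have -> : (h * 2 ^ t.+1 + (2 ^ t + r) + 2 ^ t = h.+1 * 2 ^ t.+1 + r)%N.
  by rewrite mulSn expnS; lia.
rewrite (pow2_split tn) !modn_MD //.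
have b : qbit t ((h.+1 %% 2 ^ (n - t.+1)) * 2 ^ t.+1 + (2 ^ t + r))%N.
  rewrite /qbit expnS mulnA addnA -{2}[(2 ^ t)%N]mul1n -mulnDl divnMDl ?pow2_gt0 //.
  by rewrite divn_small // addn0 oddD oddM andbF.
split=> //; by rewrite /flip b setbit_MD // mul0n add0n modnDl (modn_small rt).
Qed.

End Increment.

(** * Permutation and diagonal matrices; the increment as a ripple of carries *)

Section PermDiag.
Variables (R : realType) (d n : nat).
Hypothesis dn : d = (2 ^ n)%N.
Local Notation C := R[i].

(** Sends the basis state j to f j. As [f] lives on all naturals, composition has to know that the
    inner map stays below [d]. *)
Definition pmx (f : nat -> nat) : 'M[C]_d := \matrix_(i, j) (i == f j :> nat)%:R.

Definition dg (f : nat -> C) : 'M[C]_d := \matrix_(i, j) (if i == j then f i else 0).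

Lemma eq_pmx f g : (forall k, (k < d)%N -> f k = g k) -> pmx f = pmx g.
Proof. by move=> fg; apply/matrixP => i j; rewrite !mxE fg. Qed.

Lemma pmx_id : pmx id = 1%:M.
Proof. by apply/matrixP => i j; rewrite !mxE. Qed.

Lemma pmxM f g : (forall k, (k < d)%N -> (g k < d)%N) -> pmx f *m pmx g = pmx (f \o g).
Proof.
move=> gd; apply/matrixP => i j; rewrite !mxE.
rewrite (bigD1 (Ordinal (gd j (ltn_ord j)))) //= !mxE /= eqxx mulr1 big1 ?addr0 // => k kj.
by rewrite !mxE (negbTE (_ : (k != g j :> nat))) ?mulr0.
Qed.

Lemma eq_dg f g : (forall k, (k < d)%N -> f k = g k) -> dg f = dg g.
Proof. by move=> fg; apply/matrixP => i j; rewrite !mxE; case: ifP => // _; rewrite fg. Qed.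

Lemma mul_dgmx p f (M : 'M[C]_(d, p)) i j : (dg f *m M) i j = f i * M i j.
Proof.
rewrite mxE (bigD1 i) //= mxE eqxx big1 ?addr0 // => k.
by rewrite mxE eq_sym => /negbTE ->; rewrite mul0r.
Qed.

Lemma mul_mxdg p f (M : 'M[C]_(p, d)) i j : (M *m dg f) i j = M i j * f j.
Proof.
rewrite mxE (bigD1 j) //= mxE eqxx big1 ?addr0 // => k.
by rewrite mxE => /negbTE ->; rewrite mulr0.
Qed.

Lemma dgM f g : dg f *m dg g = dg (fun k => f k * g k).
Proof.
apply/matrixP => i j; rewrite mul_dgmx !mxE; case: eqP => // _.
by rewrite mulr0.
Qed.

Lemma dg1 : dg (fun=> 1) = 1%:M.
Proof. by apply/matrixP => i j; rewrite !mxE; case: eqP. Qed.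

Lemma dg_tC f : (dg f) ^t* = dg (fun k => (f k)^*).
Proof.
apply/matrixP => i j; rewrite !mxE eq_sym.
by case: eqP => [->|]; rewrite ?rmorph0.
Qed.

Lemma pmx_dg f g : (forall k, (k < d)%N -> (f k < d)%N) ->
  dg g *m pmx f = pmx f *m dg (g \o f).
Proof.
move=> fd; apply/matrixP => i j; rewrite mul_dgmx mul_mxdg mxE /= mulrC.
by case: eqP => [->//|]; rewrite !mul0r.
Qed.

Lemma pmx_tC f : (forall k, f (f k) = k) -> (pmx f) ^t* = pmx f.
Proof.
move=> ff; apply/matrixP => i j; rewrite !mxE rmorph_nat; congr (nat_of_bool _)%:R.
by apply/eqP/eqP => ->; rewrite ff.
Qed.

Lemma dg_gate1_comm q f (G : 'M[C]_2) :
  (forall k b, (k < d)%N -> f (setbit q b k) = f k) ->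
  dg f *m gate1 d q G = gate1 d q G *m dg f.
Proof.
move=> fq; apply/matrixP => i j; rewrite mul_dgmx mul_mxdg mxE mulrC.
by case: ifP => [/setbit_same ->|]; rewrite ?mul0r ?fq // !mul0r.
Qed.

Definition diag2 (a b : C) : 'M[C]_2 :=
  \matrix_(i, j) (if i == j then (if i == 0 then a else b) else 0).

Lemma gate1_diag2 q a b : (q < n)%N ->
  gate1 d q (diag2 a b) = dg (fun k => if qbit q k then b else a).
Proof.
move=> qn; apply/matrixP => i j; rewrite (gate1E dn) // mxE.
rewrite (bigD1 (qord q i)) //= big1 ?addr0.
  rewrite (setord_id dn) // mxE eqxx -[qord q i == 0]negbK qordE.
  by case: (i == j); case: qbit; rewrite ?mulr1 ?mulr0.
by move=> c ci; rewrite mxE eq_sym (negbTE ci) mul0r.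
Qed.

Lemma gate1_PX q : (q < n)%N -> gate1 d q PX = pmx (flip q).
Proof.
move=> qn; apply/matrixP => i j; rewrite !mxE.
have -> : (i == flip q j :> nat) = 
   ((i %/ 2 ^ q.+1 == j %/ 2 ^ q.+1)%N && (i %% 2 ^ q == j %% 2 ^ q)%N) && (qbit q i != qbit q j).
  apply/eqP/idP => [->|/andP[/andP[/eqP ij1 /eqP ij2] ij3]].
    by rewrite /flip setbit_divS setbit_mod !eqxx qbit_setbit; case: qbit.
  rewrite /flip -(_ : qbit q i = ~~ qbit q j) -?setbit_same ?ij1 ?ij2 ?eqxx //.
  by move: ij3; do 2!case: qbit.
case: ifP => //= _; congr (nat_of_bool _)%:R; congr (~~ _).
rewrite -val_eqE /= !inordK; first by do 2!case: qbit.
all: by case: qbit.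
Qed.

Definition mcflip (cs : {set 'I_n}) (t : 'I_n) (k : nat) : nat :=
  if [forall c in cs, qbit c k] then flip t k else k.

Lemma mcXE cs t : mcX R d cs t = pmx (mcflip cs t).
Proof.
apply/matrixP => i j; rewrite [LHS]mxE gate1_PX // !mxE /mcflip.
by case: ifP.
Qed.

Definition low (t k : nat) : bool := [forall c : 'I_n, (c < t)%N ==> qbit c k].

Lemma low0 k : low 0 k.
Proof. exact/forallP. Qed.

Lemma lowS (t : 'I_n) k : low t.+1 k = low t k && qbit t k.
Proof.
apply/forallP/andP => [H|[/forallP H b] c].
  split; last by have /implyP := H t; apply.
  by apply/forallP => c; apply/implyP => ct; have /implyP := H c; apply; apply: leqW.
apply/implyP; rewrite ltnS leq_eqVlt => /orP[/eqP ->//|].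
by have /implyP := H c.
Qed.

(** The invariant of the ripple: before gate [t] acts, the gates above it have added 2^(t+1) exactly
    when the digits 0 to [t] are all 1. If the lower digits are 1 and digit [t] is 0, the gate adds
    2^t without carry; if digit [t] is also 1, its flip completes the carry already made. *)
Lemma mcflip_inc (t : 'I_n) k : (k < d)%N ->
  mcflip [set c : 'I_n | (c < t)%N] t (if low t.+1 k then inc n t.+1 k else k)
  = if low t k then inc n t k else k.
Proof.
move=> kd.
have lowE x : [forall c in [set c : 'I_n | (c < t)%N], qbit c x] = low t x.
  by apply: eq_forallb => c; rewrite inE.
rewrite /mcflip !lowE lowS.
case lk: (low t k) => /=; last by rewrite lk.
case b: (qbit t k); last by rewrite lk (@flip_inc0 n) ?b // -dn.
have [e1 e2] := flip_inc1 (ltn_ord t) b; rewrite e1 ifT //.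
(* Adding 2^(t+1) leaves the lower digits alone, so the controls still read the digits of [k]. *)
have cc (c : 'I_n) : (c < t)%N -> qbit c (inc n t.+1 k) = qbit c k.
  move=> ct; rewrite -(qbit_mod _ (leqW ct)) /inc modn_dvdm ?dvdn_exp2l //.
  by rewrite modnDr qbit_mod // leqW.
apply/forallP => c; apply/implyP => ct; rewrite cc //.
by have /forallP/(_ c)/implyP := lk; apply.
Qed.

(* The carry ripples from the top wire down. *)
Lemma prod_mcX (t : nat) : (t <= n)%N ->
  \prod_(s < n | (t <= s)%N) mcX R d [set c : 'I_n | (c < s)%N] s
  = pmx (fun k => if low t k then inc n t k else k).
Proof.
(* Downward induction on [t] through [n - t]: the lowest wire is the leftmost factor and acts
   last. *)
move=> tn; rewrite -(subKn tn); move: (n - t)%N (leq_subr t n) => {t tn} u.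
elim: u => [_|u IH un].
  rewrite subn0 big_pred0 => [|s]; last by rewrite leqNgt ltn_ord.
  transitivity (pmx id); first by rewrite pmx_id.
  apply: eq_pmx => k kd; rewrite /inc modnDr modn_small ?if_same //.
  by rewrite -dn.
have tn : (n - u.+1 < n)%N by rewrite ltn_subrL (leq_trans _ un).
have et : (n - u = (n - u.+1).+1)%N by rewrite subnSK.
pose t := Ordinal tn.
have -> : \prod_(s < n | (n - u.+1 <= s)%N) mcX R d [set c : 'I_n | (c < s)%N] s
  = mcX R d [set c : 'I_n | (c < t)%N] t *
    \prod_(s < n | (n - u <= s)%N) mcX R d [set c : 'I_n | (c < s)%N] s.
  (* Extended to all naturals, the factors form an interval product, from which the one at [t]
     splits off. *)
  pose F (s : nat) := mcX R d [set c : 'I_n | (c < s)%N] (insubd t s).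
  have FE (s : 'I_n) : mcX R d [set c : 'I_n | (c < s)%N] s = F s.
    by rewrite /F; congr mcX; apply: val_inj; rewrite val_insubd ltn_ord.
  under eq_bigr do rewrite FE.
  under [in RHS]eq_bigr do rewrite FE.
  have key v : \prod_(s < n | (v <= s)%N) F s = \prod_(v <= s < n) F s.
    by rewrite big_geq_mkord.
  by rewrite !key (big_ltn tn) et FE.
rewrite IH ?(ltnW un) // -[_ * _]/(_ *m _) mcXE pmxM; last first.
  by move=> k kd; case: ifP => // _; rewrite [X in (_ < X)%N]dn inc_lt.
rewrite et; apply: eq_pmx => k kd; exact: (mcflip_inc t kd).
Qed.

End PermDiag.

(** * Elementary circuits and the Fourier diagonalization of the increment *)

Section Circuits.
Variables (R : realType) (d n : nat).
Hypothesis dn : d = (2 ^ n)%N.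
Local Notation C := R[i].
Local Notation op := 'M[C]_d.
Local Notation pmx := (@pmx R d).
Local Notation dg := (@dg R d).

Definition circuit (k : nat) (M : op) : Prop :=
  exists s : seq op, [/\ elementary_circuit n s, (size s <= k)%N & M = \prod_(G <- s) G].

Lemma circuit1 : circuit 0 1%:M.
Proof. by exists [::]; split=> //; rewrite big_nil. Qed.

Lemma circuitM j k M N : circuit j M -> circuit k N -> circuit (j + k) (M *m N).
Proof.
move=> [s [es ss ->]] [t [et st ->]]; exists (s ++ t); split; last by rewrite big_cat.
  by move=> G; rewrite mem_cat => /orP[/es|/et].
by rewrite size_cat leq_add.
Qed.

Lemma circuit_leq j k M : (j <= k)%N -> circuit j M -> circuit k M.
Proof. by move=> jk [s [es ss ->]]; exists s; split=> //; exact: leq_trans jk. Qed.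

Lemma circuit_elementary M : elementary n M -> circuit 1 M.
Proof. by move=> eM; exists [:: M]; split=> [G||] //; rewrite ?inE ?big_seq1 // => /eqP ->. Qed.

Lemma circuit_gate1 q (u : 'M[C]_2) : (q < n)%N -> u \is unitarymx -> circuit 1 (gate1 d q u).
Proof. by move=> qn uu; apply: circuit_elementary; left; exists (Ordinal qn), u. Qed.

Definition cflip (c t k : nat) : nat := if qbit c k then flip t k else k.

Lemma cflip_lt c t k : (t < n)%N -> (k < d)%N -> (cflip c t k < d)%N.
Proof. by move=> tn; rewrite /cflip dn; case: ifP => // _; exact: flip_lt. Qed.

Lemma cflipK c t : c != t -> involutive (cflip c t).
Proof.
move=> ct k; rewrite /cflip; case b: (qbit c k); last by rewrite b.
by rewrite qbit_flip_neq // b flipK.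
Qed.

Lemma cnotE (c t : 'I_n) : mcX R d [set c] t = pmx (cflip c t).
Proof.
rewrite mcXE; apply: eq_pmx => k kd; rewrite /mcflip /cflip.
congr (if _ then _ else _); apply/forallP/idP => [/(_ c)|b x].
  by rewrite inE eqxx.
by rewrite inE; apply/implyP => /eqP ->.
Qed.

Lemma circuit_cnot c t : (c < n)%N -> (t < n)%N -> c != t -> circuit 1 (pmx (cflip c t)).
Proof.
move=> cn tn ct; apply: circuit_elementary; right.
by exists (Ordinal cn), (Ordinal tn); split=> //; rewrite cnotE.
Qed.

Lemma elementary_tC (M : op) : elementary n M -> elementary n (M ^t*).
Proof.
case=> [[q [u [uu ->]]]|[c [t [ct ->]]]].
  by left; exists q, (u ^t*); split; rewrite ?trmxC_unitary // gate1_tC.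
right; exists c, t; split=> //; rewrite cnotE pmx_tC //; exact: cflipK.
Qed.

Lemma elementary_unitary (M : op) : elementary n M -> M \is unitarymx.
Proof.
case=> [[q [u [uu ->]]]|[c [t [ct ->]]]]; first exact: (gate1_unitary dn).
have ff : involutive (cflip c t) by exact: cflipK.
rewrite cnotE; apply/unitarymxP; rewrite pmx_tC // pmxM; last by move=> k; exact: cflip_lt.
by rewrite -pmx_id; apply: eq_pmx => k _ /=; rewrite ff.
Qed.

Lemma mulmx_tC k l m (M : 'M[C]_(k, l)) (N : 'M[C]_(l, m)) : (M *m N) ^t* = N ^t* *m M ^t*.
Proof. by rewrite trmx_mul map_mxM. Qed.

Lemma scalar1_tC k : (1%:M : 'M[C]_k) ^t* = 1%:M.
Proof. by rewrite tr_scalar_mx map_scalar_mx rmorph1. Qed.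

Lemma unitarymx_tCK k (M : 'M[C]_k) : M \is unitarymx -> M ^t* *m M = 1%:M.
Proof. by rewrite -trmxC_unitary => /unitarymxP; rewrite trmxCK. Qed.

Lemma circuit_tC k M : circuit k M -> circuit k (M ^t*).
Proof.
move=> [s [es ss ->]]; elim: s k es ss => [|G s IH] k es ss.
  by rewrite big_nil scalar1_tC; apply: circuit_leq circuit1.
case: k ss => // k ss; rewrite big_cons mulmx_tC -addn1; apply: circuitM.
  by apply: IH => // H Hs; apply: es; rewrite inE Hs orbT.
by apply/circuit_elementary/elementary_tC/es; rewrite mem_head.
Qed.

Lemma circuit_unitary k M : circuit k M -> M \is unitarymx.
Proof.
move=> [s [es _ ->]]; elim: s es => [|G s IH] es.
  by rewrite big_nil; apply/unitarymxP; rewrite scalar1_tC mulmx1.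
rewrite big_cons; apply: mul_unitarymx; first by apply/elementary_unitary/es; rewrite mem_head.
by apply: IH => H Hs; apply: es; rewrite inE Hs orbT.
Qed.

Lemma diag2_unitary (a b : C) : a * a^* = 1 -> b * b^* = 1 -> diag2 a b \is unitarymx.
Proof.
move=> a1 b1; apply/unitarymxP/matrixP => i j; rewrite !mxE big_ord_recl big_ord1 !mxE.
by case: i => [[|[|]]] //= ?; case: j => [[|[|]]] //= ?;
  rewrite ?rmorph0 ?mul0r ?mulr0 ?addr0 ?add0r.
Qed.

Definition phase (b : bool) (a : R) : C := if b then expi a else 1.

Lemma phaseD b x y : phase b (x + y) = phase b x * phase b y.
Proof. by rewrite /phase; case: b; rewrite ?expiD ?mulr1. Qed.

Lemma phase0 b : phase b 0 = 1.
Proof. by rewrite /phase expi0 if_same. Qed.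

Lemma phase_conj b a : (phase b a)^* = phase b (- a).
Proof. by rewrite /phase; case: b; rewrite ?conj_expi ?rmorph1. Qed.

Lemma circuit_phase q a : (q < n)%N -> circuit 1 (dg (fun k => phase (qbit q k) a)).
Proof.
move=> qn; rewrite -(gate1_diag2 dn 1 (expi a) qn); apply: circuit_gate1 => //.
by apply: diag2_unitary; rewrite ?rmorph1 ?mulr1 // conj_expi -expiD subrr expi0.
Qed.

(* exp(i a b c) = exp(i a/2 (b + c - (b xor c))) for bits b and c. *)
Lemma circuit_cphase l q a : (l < n)%N -> (q < n)%N -> l != q ->
  circuit 5 (dg (fun k => phase (qbit l k && qbit q k) a)).
Proof.
move=> ln qn lq.
have -> : dg (fun k => phase (qbit l k && qbit q k) a) =
  dg (fun k => phase (qbit l k) (a / 2)) *m (dg (fun k => phase (qbit q k) (a / 2)) *m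
  (pmx (cflip l q) *m (dg (fun k => phase (qbit q k) (- (a / 2))) *m pmx (cflip l q)))).
  have fl k : (k < d)%N -> (cflip l q k < d)%N by exact: cflip_lt.
  rewrite pmx_dg // [pmx _ *m _]mulmxA pmxM // (_ : pmx _ = 1%:M); last first.
    rewrite -pmx_id; apply: eq_pmx => k _ /=; exact: cflipK.
  rewrite mul1mx !dgM; apply: eq_dg => k _ /=.
  have -> : qbit q (cflip l q k) = qbit l k (+) qbit q k.
    by rewrite /cflip; case: (qbit l k) => //=; rewrite qbit_flip.
  have aa : a / 2 + a / 2 = a by field.
  case: (qbit l k) (qbit q k) => [] [] /=; rewrite /phase ?mulr1 ?mul1r //.
  - by rewrite -expiD aa.
  - by rewrite -expiD subrr expi0.
  - by rewrite -expiD subrr expi0.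
rewrite -[5%N]/(1 + (1 + (1 + (1 + 1))))%N.
by do !apply: circuitM; do ?apply: circuit_phase => //; exact: circuit_cnot.
Qed.

Definition hadamard : 'M[C]_2 := (sqrtC 2%:R)^-1 *: (PX + PZ).

(** The diagonal of a product of phase gates diag(1, e^{i al q}) on the wires l <= q < n; the
    eigenvalues of [inc n l] take this form. *)
Definition upper (l : nat) (al : nat -> R) (k : nat) : C :=
  \prod_(l <= q < n) phase (qbit q k) (al q).

Lemma upper_setbit l al p b k : (p < l)%N -> upper l al (setbit p b k) = upper l al k.
Proof.
move=> pl; rewrite /upper big_nat_cond [RHS]big_nat_cond; apply: eq_bigr => q /andP[/andP[lq _] _].
by rewrite qbit_setbit_neq // gtn_eqF // (leq_trans pl).
Qed.

Lemma upperD l al be k : upper l (fun q => al q + be q) k = upper l al k * upper l be k.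
Proof. by rewrite -big_split; apply: eq_bigr => q _; exact: phaseD. Qed.

Lemma upperN_mul l al k : upper l (fun q => - al q) k * upper l al k = 1.
Proof. by rewrite -upperD; apply: big1 => q _; rewrite addNr phase0. Qed.

Lemma upper_conj l al k : (upper l al k)^* = upper l (fun q => - al q) k.
Proof. by rewrite rmorph_prod; apply: eq_bigr => q _; exact: phase_conj. Qed.

Lemma circuit_prod_dg j (f : nat -> nat -> C) l (lo : (l <= n)%N) :
  (forall q, (l <= q < n)%N -> circuit j (dg (f q))) ->
  circuit (j * (n - l)) (dg (fun k => \prod_(l <= q < n) f q k)).
Proof.
suff H u : (u <= n)%N -> (forall q, (n - u <= q < n)%N -> circuit j (dg (f q))) ->
    circuit (j * u) (dg (fun k => \prod_(n - u <= q < n) f q k)).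
  by have := H (n - l)%N (leq_subr l n); rewrite subKn.
elim: u => [_ _|u IH un cf].
  rewrite muln0 (_ : dg _ = 1%:M); first exact: circuit1.
  by rewrite -dg1; apply: eq_dg => k _; rewrite subn0 big_geq.
have tn : (n - u.+1 < n)%N by rewrite ltn_subrL (leq_trans _ un).
have et : (n - u = (n - u.+1).+1)%N by rewrite subnSK.
rewrite (_ : dg _ = dg (f (n - u.+1)%N) *m dg (fun k => \prod_(n - u <= q < n) f q k)).
  rewrite mulnS; apply: circuitM; first by apply: cf; rewrite leqnn tn.
  apply: IH; rewrite ?(ltnW un) // => q /andP[lq qn]; apply: cf.
  by rewrite qn andbT (leq_trans _ lq) // et.
by rewrite dgM; apply: eq_dg => k _; rewrite (big_ltn tn) et.
Qed.

Lemma circuit_upper l al : (l <= n)%N -> circuit (n - l) (dg (upper l al)).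
Proof.
move=> ln; rewrite -[(n - l)%N]mul1n.
by apply: circuit_prod_dg => // q /andP[_ qn]; exact: circuit_phase.
Qed.

(** A control on wire [l] distributes over the one-qubit phases, each of which becomes a controlled
    phase of five gates. *)
Lemma circuit_cupper l al : (l < n)%N ->
  circuit (5 * (n - l.+1)) (dg (fun k => if qbit l k then upper l.+1 al k else 1)).
Proof.
move=> ln; rewrite (_ : dg _ = dg (fun k => \prod_(l.+1 <= q < n)
  phase (qbit l k && qbit q k) (al q))).
  by apply: circuit_prod_dg => // q /andP[lq qn]; apply: circuit_cphase; rewrite ?ltn_eqF.
apply: eq_dg => k _; case: ifP => //= _; rewrite big1 // => q _.
Qed.

Lemma sqr_invsqrt2 : (sqrtC 2%:R : C)^-1 * (sqrtC 2%:R)^-1 = 2^-1.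
Proof. by rewrite -invfM -expr2 sqrtCK. Qed.

Lemma conj_invsqrt2 : ((sqrtC 2%:R : C)^-1)^* = (sqrtC 2%:R)^-1.
Proof. by rewrite fmorphV /=; congr (_^-1); apply: CrealP; rewrite ger0_real // sqrtC_ge0. Qed.

Lemma half1 : (2%:R : C)^-1 + 2^-1 = 1.
Proof. by rewrite [RHS](splitr 1) !mul1r. Qed.

Lemma hadamard_tC : hadamard ^t* = hadamard.
Proof.
apply/matrixP => i j; rewrite !mxE rmorphM [X in X * _]conj_invsqrt2; congr (_ * _).
rewrite rmorphD eq_sym rmorph_nat; congr (_ + _); rewrite eq_sym.
by case: eqP => [->|]; rewrite ?rmorph0 // rmorphXn rmorphN rmorph1.
Qed.

Lemma PX2 : (PX : 'M[C]_2) *m PX = 1%:M.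
Proof.
apply/matrixP => i j; rewrite !mxE big_ord_recl big_ord1 !mxE.
by case: i => [[|[|]]] //= ?; case: j => [[|[|]]] //= ?;
  rewrite ?mul0r ?mulr0 ?mulr1 ?addr0 ?add0r.
Qed.

Lemma PZ2 : (PZ : 'M[C]_2) *m PZ = 1%:M.
Proof.
apply/matrixP => i j; rewrite !mxE big_ord_recl big_ord1 !mxE.
by case: i => [[|[|]]] //= ?; case: j => [[|[|]]] //= ?;
  rewrite ?mul0r ?mulr0 ?mulr1 ?addr0 ?add0r ?expr1 ?mulrNN ?mulr1.
Qed.

Lemma PXZ : (PX : 'M[C]_2) *m PZ = - (PZ *m PX).
Proof.
apply/matrixP => i j; rewrite !mxE !big_ord_recl !big_ord0 !mxE.
by case: i => [[|[|]]] //= ?; case: j => [[|[|]]] //= ?;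
  rewrite ?mul0r ?mulr0 ?mulr1 ?addr0 ?add0r ?expr1 ?mul1r ?oppr0 ?opprK.
Qed.

(** The normalized sum of two anticommuting involutions is an involution, and by [conj_hadamard] it
    exchanges them. With X and Z it is the Hadamard gate, with X and Y it is [Htilde]. *)
Lemma mul_hadamard (M N : 'M[C]_2) : M *m M = 1%:M -> N *m N = 1%:M -> M *m N = - (N *m M) ->
  (sqrtC 2%:R)^-1 *: (M + N) *m ((sqrtC 2%:R)^-1 *: (M + N)) = 1%:M.
Proof.
move=> MM NN MN; rewrite -scalemxAl -scalemxAr scalerA sqr_invsqrt2.
rewrite mulmxDl !mulmxDr MM NN MN addrA addrNK.
by rewrite scalerDr -scalerDl half1 scale1r.
Qed.

Lemma conj_hadamard (M N : 'M[C]_2) : M *m M = 1%:M -> N *m N = 1%:M -> M *m N = - (N *m M) ->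
  (sqrtC 2%:R)^-1 *: (M + N) *m M *m ((sqrtC 2%:R)^-1 *: (M + N)) = N.
Proof.
move=> MM NN MN; rewrite -!scalemxAl -scalemxAr scalerA sqr_invsqrt2.
rewrite mulmxDl !mulmxDr mulmxDl mulmxDl MM mul1mx mul1mx -!mulmxA MM MN mulmx1 mulmxN mulmxA NN mul1mx.
rewrite [X in _ *: X]addrC addrA subrK.
by rewrite scalerDr -scalerDl half1 scale1r.
Qed.

Lemma hadamard2 : hadamard *m hadamard = 1%:M.
Proof. by apply: mul_hadamard; [exact: PX2|exact: PZ2|exact: PXZ]. Qed.

Lemma hadamardZ : hadamard *m PZ *m hadamard = PX.
Proof.
rewrite /hadamard addrC; apply: conj_hadamard; rewrite ?PX2 ?PZ2 //.
by rewrite PXZ opprK.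
Qed.

Lemma hadamard_unitary : hadamard \is unitarymx.
Proof. by apply/unitarymxP; rewrite hadamard_tC hadamard2. Qed.

Lemma PZ_diag2 : PZ = diag2 (1 : C) (-1).
Proof. by apply/matrixP => i j; rewrite !mxE; case: i => [[|[|]]] //= ?; case: j => [[|[|]]]. Qed.

(* One step of the Fourier diagonalization of the increment: given the eigenvalues of the
   increment of the wires > l, the increment of the wires >= l has their square roots times
   (-1) ^ (bit l). *)
Lemma increment_step l al : (l < n)%N ->
  let K := dg (fun k => if qbit l k then upper l.+1 (fun q => - al q / 2) k else 1) in
  gate1 d l PX *m dg (fun k => if qbit l k then upper l.+1 al k else 1)
  = K *m gate1 d l hadamard *m
    dg (upper l (fun q => if q == l then pi else al q / 2)) *m (K *m gate1 d l hadamard) ^t*.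
Proof.
move=> ln K; pose al2 := fun q => al q / 2.
have -> : dg (upper l (fun q => if q == l then pi else al2 q)) =
    gate1 d l PZ *m dg (upper l.+1 al2).
  rewrite PZ_diag2 (gate1_diag2 dn) // dgM; apply: eq_dg => k _.
  rewrite {1}/upper (big_ltn ln) eqxx; congr (_ * _).
    by rewrite /phase /expi cospi sinpi; case: ifP => // _; apply/eqP; rewrite eq_complex /= oppr0 !eqxx.
  by rewrite /upper big_nat_cond [RHS]big_nat_cond; apply: eq_bigr => q /andP[/andP[lq _] _]; rewrite gtn_eqF.
have sb k b : (k < d)%N -> upper l.+1 al2 (setbit l b k) = upper l.+1 al2 k.
  by move=> _; rewrite upper_setbit.
rewrite mulmx_tC gate1_tC hadamard_tC.
(* A diagonal that ignores wire [l] moves past the Hadamard gate, so that Z is conjugated into X.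
   With V the given eigenvalues, the remaining diagonals agree: on digit 1 two factors V^{1/2} make
   V, on digit 0 the factors V^{1/2} and V^{-1/2} cancel. *)
transitivity (K *m (gate1 d l hadamard *m gate1 d l PZ *m gate1 d l hadamard)
    *m (dg (upper l.+1 al2) *m K ^t*)); last first.
  rewrite !mulmxA -[_ *m dg _ *m gate1 d l hadamard]mulmxA.
  by rewrite (dg_gate1_comm _ sb) !mulmxA.
rewrite -!(gate1M dn) // hadamardZ (gate1_PX R d ln) pmx_dg; last first.
  by move=> k; rewrite dn; exact: flip_lt.
rewrite dg_tC -mulmxA !dgM; congr (_ *m _); apply: eq_dg => k kd /=.
rewrite qbit_flip {1}/flip upper_setbit //; case: ifP => b /=.
  by rewrite mul1r upper_conj -upperD; apply: eq_bigr => q _; congr phase; rewrite /al2; field.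
rewrite rmorph1 mulr1 -[LHS](upperN_mul l.+1 al2 k); congr (_ * _).
by apply: eq_bigr => q _; congr phase; rewrite /al2 mulNr.
Qed.

(** A digit 0 is only flipped, a digit 1 also sends a carry upward; the two diagonals are the
    projections on the values of digit [l]. *)
Lemma pmx_inc_split l : (l < n)%N ->
  pmx (inc n l) = gate1 d l PX *m
    (dg (fun k => (~~ qbit l k)%:R) + pmx (inc n l.+1) *m dg (fun k => (qbit l k)%:R)).
Proof.
move=> ln; rewrite (gate1_PX R d ln).
rewrite (_ : _ + _ = pmx (fun k => if qbit l k then inc n l.+1 k else k)).
  rewrite pmxM => [|k kd]; last by case: ifP => _ //; rewrite [X in (_ < X)%N]dn inc_lt.
  apply: eq_pmx => k kd /=; case: ifP => b; first by have [->] := flip_inc1 ln b.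
  by rewrite (@flip_inc0 n) ?b // -dn.
apply/matrixP => i j; rewrite mxE mul_mxdg !mxE.
have -> : (if i == j then (~~ qbit l i)%:R else 0) = (i == j :> nat)%:R * (~~ qbit l j)%:R :> C.
  by rewrite val_eqE; case: eqP => [->|]; rewrite ?mul1r ?mul0r.
by case: (qbit l j); rewrite ?mulr1 ?mulr0 ?add0r ?addr0.
Qed.

Lemma gate1_bit q : (q < n)%N -> dg (fun k => (qbit q k)%:R) = gate1 d q (diag2 0 1).
Proof. by move=> qn; rewrite (gate1_diag2 dn) //; apply: eq_dg => k _; case: qbit. Qed.

Lemma tC_comm k (F M : 'M[C]_k) : F \is unitarymx -> F *m M = M *m F -> F ^t* *m M = M *m F ^t*.
Proof.
move=> Fu FM; have /unitarymxP F1 := Fu; rewrite -[LHS]mulmx1 -F1 !mulmxA -[F ^t* *m M *m F]mulmxA -FM mulmxA.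
by rewrite unitarymx_tCK // mul1mx.
Qed.

(** The commutation clause carries the induction: the [F] of the wires above [l] commutes with X and
    with the digit projections on wire [l], so it also diagonalizes the increment controlled by that
    wire, and [increment_step] applies inside the conjugation. Each wire adds one Hadamard gate and
    at most 5 n gates for controlled phases. *)
Lemma increment_fourier l : (l <= n)%N ->
  exists F al, [/\ circuit ((n - l) * (5 * n + 1)) F,
    forall p (G : 'M[C]_2), (p < l)%N -> F *m gate1 d p G = gate1 d p G *m F
    & pmx (inc n l) = F *m dg (upper l al) *m F ^t*].
Proof.
move=> ln; rewrite -(subKn ln); move: (n - l)%N (leq_subr l n) => {l ln} u.
elim: u => [_|u IH un].
  exists 1%:M, (fun=> 0); split; first by rewrite subn0 subnn mul0n; exact: circuit1.
    by move=> p G _; rewrite mul1mx mulmx1.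
  rewrite scalar1_tC mul1mx mulmx1 subn0 (_ : dg _ = 1%:M); last first.
    by rewrite -dg1; apply: eq_dg => k _; rewrite /upper big_geq.
  by rewrite -pmx_id; apply: eq_pmx => k kd; rewrite /inc modnDr modn_small // -dn.
have ln : (n - u.+1 < n)%N by rewrite ltn_subrL (leq_trans _ un).
have := IH (ltnW un); rewrite (subKn (ltnW un)) (subKn un) -(subnSK un).
move: (n - u.+1)%N ln => l ln [F [al [Fc Fg FE]]].
have Fu := circuit_unitary Fc.
pose K := dg (fun k => if qbit l k then upper l.+1 (fun q => - al q / 2) k else 1).
exists (F *m (K *m gate1 d l hadamard)), (fun q => if q == l then pi else al q / 2); split.
- rewrite mulSnr; apply: circuitM => //; apply: circuitM; last first.
    by apply: circuit_gate1 => //; exact: hadamard_unitary.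
  by apply: circuit_leq (circuit_cupper _ ln); rewrite leq_mul2l leq_subr.
- move=> p G pl; have lp : l != p by rewrite gtn_eqF.
  rewrite -!mulmxA (gate1_comm dn hadamard G ln (ltn_trans pl ln) lp).
  rewrite [K *m _]mulmxA (_ : K *m gate1 d p G = gate1 d p G *m K).
    by rewrite -[gate1 d p G *m K *m _]mulmxA mulmxA (Fg _ _ (ltnW pl)) -mulmxA.
  apply: dg_gate1_comm => k b kd; rewrite qbit_setbit_neq ?gtn_eqF //.
  by rewrite upper_setbit // ltnW.
- have /unitarymxP F1 := Fu.
  have key : dg (fun k => (~~ qbit l k)%:R) + pmx (inc n l.+1) *m dg (fun k => (qbit l k)%:R)
     = F *m dg (fun k => if qbit l k then upper l.+1 al k else 1) *m F ^t*.
    have -> : dg (fun k => if qbit l k then upper l.+1 al k else 1) =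
       dg (fun k => (~~ qbit l k)%:R) + dg (upper l.+1 al) *m dg (fun k => (qbit l k)%:R).
      rewrite dgM; apply/matrixP => i j; rewrite !mxE; case: eqP => _; rewrite ?addr0 //.
      by case: qbit; rewrite ?mulr1 ?mulr0 ?add0r ?addr0.
    have bE : dg (fun k => (~~ qbit l k)%:R) = gate1 d l (diag2 1 0).
      by rewrite (gate1_diag2 dn) //; apply: eq_dg => k _; case: qbit.
    have bF : F *m dg (fun k => (~~ qbit l k)%:R) *m F ^t* = dg (fun k => (~~ qbit l k)%:R).
      by rewrite bE Fg // -mulmxA F1 mulmx1.
    rewrite mulmxDr mulmxDl bF; congr (_ + _).
    by rewrite FE gate1_bit // -!mulmxA tC_comm // Fg.
  rewrite pmx_inc_split // key !mulmxA -[gate1 _ _ _ *m F]Fg // -2!mulmxA [gate1 _ _ _ *m _]mulmxA.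
  by rewrite increment_step // -/K !mulmx_tC !mulmxA.
Qed.

Lemma circuit_inc l : (l <= n)%N -> circuit (2 * (n * (5 * n + 1)) + n) (pmx (inc n l)).
Proof.
move=> ln; have [F [al [Fc _ ->]]] := increment_fourier ln.
have Fc' : circuit (n * (5 * n + 1)) F.
  by apply: circuit_leq Fc; rewrite leq_mul2r leq_subr orbT.
apply: (@circuit_leq (n * (5 * n + 1) + n + n * (5 * n + 1))); first by lia.
apply: circuitM (circuit_tC Fc'); apply: circuitM => //.
by apply: circuit_leq (circuit_upper _ ln); rewrite leq_subr.
Qed.

End Circuits.

(** * Majorana operators in the Heisenberg picture *)

Lemma half_conj_sum (F : numFieldType) (a b : F) : (a - b + (a + b)) / 2%:R = a.
Proof. by field. Qed.

Lemma half_conj_diff (F : numFieldType) (a b : F) : (a - b - (a + b)) / 2%:R = - b.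
Proof. by field. Qed.

Section Clifford.
Variables (R : realType) (D : nat).
Local Notation C := R[i].
Local Notation op := 'M[C]_D.

Definition clifford (I : eqType) (x : I -> op) : Prop :=
  [/\ forall a, (x a) ^t* = x a, forall a, x a *m x a = 1%:M
    & forall a b, a != b -> x a *m x b = - (x b *m x a)].

Lemma clifford_inj (I J : eqType) (x : I -> op) (f : J -> I) :
  injective f -> clifford x -> clifford (x \o f).
Proof.
move=> fi [xh x2 xa]; split=> [a|a|a b ab] /=; rewrite ?xh ?x2 //.
by apply: xa; rewrite inj_eq.
Qed.

Lemma mulmx_exchange4 (a b c e : op) :
  b *m c = - (c *m b) -> a *m c = - (c *m a) -> b *m e = - (e *m b) -> a *m e = - (e *m a) ->
  a *m b *m (c *m e) = c *m e *m (a *m b).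
Proof.
move=> bc ac be ae.
rewrite -!mulmxA (mulmxA b c e) bc mulNmx -(mulmxA c b e) be !mulmxN opprK.
by rewrite (mulmxA a c) ac mulNmx -(mulmxA c a) (mulmxA a e) ae mulNmx mulmxN opprK -(mulmxA e a b).
Qed.

Lemma rotmx_comm t (M P : op) : M *m P = P *m M -> M *m rotmx t P = rotmx t P *m M.
Proof.
by move=> MP; rewrite /rotmx mulmxDl mulmxDr mul_mx_scalar mul_scalar_mx -scalemxAl -scalemxAr MP.
Qed.

Section Pairs.
Variables (N : nat) (x : 'I_(N * 2) -> op).
Hypothesis xC : clifford x.
Local Notation y i s := (x (mxtens_index (i, s))).

(** The product of two anticommuting hermitian involutions is antihermitian with square -1; the
    factor -i makes it a hermitian involution. *)
Definition pair_op (i : 'I_N) : op := (- 'i) *: (y i 0 *m y i 1).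

Let x2 a : x a *m x a = 1%:M. Proof. by case: xC. Qed.
Let xh a : (x a) ^t* = x a. Proof. by case: xC. Qed.

Let pair_neq i j s t : (i, s) != (j, t) -> mxtens_index (i, s) != mxtens_index (j, t) :> 'I_(N * 2).
Proof. by rewrite (inj_eq (can_inj (@mxtens_indexK N 2))). Qed.

Let anti i j s t : (i, s) != (j, t) -> y i s *m y j t = - (y j t *m y i s).
Proof. by move=> ne; case: xC => _ _; apply; exact: pair_neq. Qed.

Let anti_ij i j s t : i != j -> y i s *m y j t = - (y j t *m y i s).
Proof. by move=> ij; apply: anti; rewrite xpair_eqE negb_and ij. Qed.

Let anti01 i : y i 1 *m y i 0 = - (y i 0 *m y i 1).
Proof. by apply: anti; rewrite xpair_eqE negb_and orbT. Qed.

Lemma pair_op_tC i : (pair_op i) ^t* = pair_op i.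
Proof.
rewrite /pair_op linearZ /= map_mxZ mulmx_tC !xh anti01 /= rmorphN /= conjCi.
by rewrite scalerN opprK scaleNr.
Qed.

Lemma pair_op2 i : pair_op i *m pair_op i = 1%:M.
Proof.
rewrite /pair_op -scalemxAl -scalemxAr scalerA mulrNN -expr2 sqrCi.
rewrite -mulmxA [y i 1 *m _]mulmxA anti01 mulNmx mulmxN -[_ *m y i 1 *m _]mulmxA x2 mulmx1 x2.
by rewrite scaleN1r opprK.
Qed.

Lemma pair_op_comm i j : pair_op i *m pair_op j = pair_op j *m pair_op i.
Proof.
have [->//|ij] := eqVneq i j.
rewrite /pair_op -!scalemxAl -!scalemxAr; congr (_ *: (_ *: _)).
by apply: mulmx_exchange4; exact: anti_ij.
Qed.

Lemma pair_op_commx i j s : i != j -> y i s *m pair_op j = pair_op j *m y i s.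
Proof.
move=> ij; rewrite /pair_op -scalemxAl -scalemxAr; congr (_ *: _).
by rewrite mulmxA (anti_ij s 0 ij) mulNmx -(mulmxA _ (y i s)) (anti_ij s 1 ij) mulmxN opprK mulmxA.
Qed.

(* The eigenvectors of conjugation by exp(i t pair_op i) in the span of y i 0 and y i 1. *)
Definition ladder (k : C) (i : 'I_N) : op := y i 0 + ('i * k) *: y i 1.

Lemma pair_op_ladder k i : k * k = 1 -> pair_op i *m ladder k i = k *: ladder k i.
Proof.
move=> kk; rewrite /pair_op /ladder mulmxDr -!scalemxAr -!scalemxAl.
rewrite -!mulmxA anti01 x2 mulmx1 mulmxN mulmxA x2 mul1mx scalerDr !scalerA addrC.
congr (_ + _).
  by rewrite mulrN mulrAC -expr2 sqrCi mulN1r opprK.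
by rewrite scalerN scaleNr opprK mulrCA kk mulr1.
Qed.

Lemma ladder_pair_op k i : k * k = 1 -> ladder k i *m pair_op i = - (k *: ladder k i).
Proof.
move=> kk; rewrite /pair_op /ladder mulmxDl -!scalemxAr -!scalemxAl.
rewrite !mulmxA anti01 x2 mul1mx mulNmx -mulmxA x2 mulmx1 scalerDr !scalerA addrC opprD.
congr (_ + _).
  by rewrite scalerN mulNr mulrA -expr2 sqrCi mulN1r opprK.
by rewrite mulrCA kk mulr1 scaleNr.
Qed.

Lemma expi_sign (b : bool) (t : R) :
  expi ((-1) ^+ b * t) = (cos t)%:C + 'i * (sin t)%:C * (-1) ^+ b.
Proof.
rewrite expiE; case: b; rewrite ?expr1 ?expr0 ?mul1r ?mulr1 // mulN1r.
by rewrite cosN sinN rmorphN mulrN mulrN1.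
Qed.

Lemma sqr_sign (b : bool) : (-1) ^+ b * (-1) ^+ b = 1 :> C.
Proof. by rewrite -expr2 -exprM mulnC exprM sqrrN !expr1n. Qed.

Lemma rotmx_ladder t (b : bool) i :
  rotmx t (pair_op i) *m ladder ((-1) ^+ b) i = expi ((-1) ^+ b * t) *: ladder ((-1) ^+ b) i.
Proof.
rewrite /rotmx mulmxDl mul_scalar_mx -scalemxAl pair_op_ladder ?sqr_sign //.
by rewrite scalerA -scalerDl expi_sign.
Qed.

Lemma ladder_rotmx t (b : bool) i :
  ladder ((-1) ^+ b) i *m rotmx t (pair_op i) = expi (- ((-1) ^+ b * t)) *: ladder ((-1) ^+ b) i.
Proof.
rewrite /rotmx mulmxDr mul_mx_scalar -scalemxAr ladder_pair_op ?sqr_sign //.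
by rewrite -mulrN expi_sign cosN sinN rmorphN mulrN mulNr -scaleNr scalerA mulrN -scalerDl.
Qed.

Definition pair_evol (t : R) : op := expmx (('i * t%:C) *: \sum_(i < N) pair_op i).

Lemma pair_evolE t : pair_evol t = \prod_(i < N) rotmx t (pair_op i).
Proof. exact: (expmx_sum_invol t (fun i _ => pair_op2 i) (fun i j _ _ => pair_op_comm i j)). Qed.

Lemma pair_evol_unitary t : pair_evol t \is unitarymx.
Proof.
rewrite pair_evolE; elim/big_rec: _ => [|i M _ Mu].
  by apply/unitarymxP; rewrite scalar1_tC mulmx1.
by apply: mul_unitarymx Mu; apply: rotmx_unitary; rewrite ?pair_op_tC ?pair_op2.
Qed.

(** The factors of the other pairs commute with the ladder operator. With k the sign, the factor of
    pair [i] is e^{-ikt} when it stands on the right and e^{ikt} on the left, so moving it across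
    costs e^{-2ikt}. *)
Lemma ladder_pair_evol t (b : bool) i :
  ladder ((-1) ^+ b) i *m pair_evol t
  = expi (- ((-1) ^+ b * (t + t))) *: (pair_evol t *m ladder ((-1) ^+ b) i).
Proof.
set k : C := (-1) ^+ b in |- *.
pose c j : C := if j == i then expi (- ((-1) ^+ b * (t + t))) else 1.
have lr j : ladder k i *m rotmx t (pair_op j) = c j *: (rotmx t (pair_op j) *m ladder k i).
  rewrite /c; case: eqP => [->|/eqP ji].
    rewrite ladder_rotmx rotmx_ladder scalerA -expiD; congr (expi _ *: _).
    by rewrite mulrDr opprD addrNK.
  have lp : ladder k i *m pair_op j = pair_op j *m ladder k i.
    have ij : i != j by rewrite eq_sym.
    move: (pair_op_commx 0 ij) (pair_op_commx 1 ij); move: (pair_op j) => P c0 c1.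
    by rewrite /ladder mulmxDl mulmxDr -scalemxAl -scalemxAr c0 c1.
  by rewrite scale1r; exact: rotmx_comm.
have -> : expi (- ((-1) ^+ b * (t + t))) = \prod_(j < N) c j.
  by rewrite /c -big_mkcond big_pred1_eq.
rewrite pair_evolE; elim: (index_enum _) => [|j r IH].
  by rewrite !big_nil mulmx1 mul1mx scale1r.
rewrite !big_cons [ladder k i *m _]mulmxA lr -scalemxAl -mulmxA IH -scalemxAr scalerA.
by rewrite mulmxA.
Qed.

Lemma ladder_pair_evol_conj t (b : bool) i :
  (pair_evol t) ^t* *m ladder ((-1) ^+ b) i *m pair_evol t
  = expi (- ((-1) ^+ b * (t + t))) *: ladder ((-1) ^+ b) i.
Proof.
rewrite -mulmxA ladder_pair_evol -[LHS]scalemxAr mulmxA.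
by rewrite (unitarymx_tCK (pair_evol_unitary t)) mul1mx.
Qed.

End Pairs.

Definition heisenberg n (x : 'I_n -> op) (U : op) (Q : 'M[C]_n) : Prop :=
  forall a, U ^t* *m x a *m U = \sum_b Q a b *: x b.

(** Conjugation by U V conjugates by [U] first. The coefficients it produces are scalars and pass
    through the conjugation by [V], so the coefficient matrices multiply in the same order as the
    operators. *)
Lemma heisenbergM n (x : 'I_n -> op) U V Q Q' :
  heisenberg x U Q -> heisenberg x V Q' -> heisenberg x (U *m V) (Q *m Q').
Proof.
move=> hU hV a; rewrite mulmx_tC -!mulmxA [x a *m _]mulmxA [U ^t* *m _]mulmxA mulmxA [U ^t* *m _]mulmxA hU.
rewrite mulmx_sumr mulmx_suml.
under eq_bigr do rewrite -scalemxAr -scalemxAl hV scaler_sumr.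
rewrite exchange_big; apply: eq_bigr => c _; rewrite mxE scaler_suml.
by apply: eq_bigr => b _; rewrite scalerA.
Qed.

Lemma heisenberg1 n (x : 'I_n -> op) : heisenberg x 1%:M 1%:M.
Proof.
move=> a; rewrite scalar1_tC mul1mx mulmx1 (bigD1 a) //= mxE eqxx scale1r big1 ?addr0 // => b.
by rewrite mxE eq_sym => /negbTE ->; rewrite scale0r.
Qed.

Lemma sum_mxtens (V : nmodType) m n (F : 'I_(m * n) -> V) :
  \sum_k F k = \sum_i \sum_j F (mxtens_index (i, j)).
Proof.
rewrite pair_big (reindex (@mxtens_index m n)) /=; first by apply: eq_bigr => -[].
by exists (@mxtens_unindex m n) => b _; rewrite (mxtens_indexK, mxtens_unindexK).
Qed.

Lemma rotmxE n t (P : 'M[C]_n) i j :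
  rotmx t P i j = (cos t)%:C * (i == j)%:R + 'i * (sin t)%:C * P i j.
Proof. by rewrite !mxE mulr_natr. Qed.

Lemma rotmx_tens1 N t (P : 'M[C]_2) : rotmx t ((1%:M : 'M[C]_N) *t P) = 1%:M *t rotmx t P.
Proof.
apply/matrixP => a b; case: (mxtens_indexP a) => i s; case: (mxtens_indexP b) => j u.
rewrite rotmxE !tensmxE rotmxE (inj_eq (can_inj (@mxtens_indexK N 2))) xpair_eqE !mxE.
by case: (i == j); rewrite /= ?mul1r ?mul0r ?mulr0 ?addr0.
Qed.

Lemma expi_half_sum (t : R) :
  (expi (- ((-1) ^+ false * t)) + expi (- ((-1) ^+ true * t))) / 2%:R = (cos t)%:C.
Proof.
rewrite expr0 expr1 mul1r mulN1r opprK !expiE cosN sinN rmorphN mulrN.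
exact: half_conj_sum.
Qed.

Lemma expi_half_diff (t : R) :
  (expi (- ((-1) ^+ false * t)) - expi (- ((-1) ^+ true * t))) / 2%:R = - ('i * (sin t)%:C).
Proof.
rewrite expr0 expr1 mul1r mulN1r opprK !expiE cosN sinN rmorphN mulrN.
exact: half_conj_diff.
Qed.

(** Half the sum and -i/2 times the difference of the two ladder operators recover [y0] and [y1], so
    the phases [e0] and [e1] combine into a rotation. The values of [a] and [b] are given by
    equations so that the signs of [ladder] unify as they stand. *)
Lemma ladder_solve (U V y0 y1 : op) (a b e0 e1 c s : C) :
  V *m (y0 + a *: y1) *m U = e0 *: (y0 + a *: y1) ->
  V *m (y0 + b *: y1) *m U = e1 *: (y0 + b *: y1) ->
  a = 'i -> b = - 'i ->
  c = (e0 + e1) / 2%:R -> - ('i * s) = (e0 - e1) / 2%:R ->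
  V *m y0 *m U = c *: y0 + s *: y1 /\ V *m y1 *m U = - s *: y0 + c *: y1.
Proof.
move=> H0 H1 ea eb cE sE; subst a b; set l0 := y0 + _ in H0; set l1 := y0 + _ in H1.
have y0E : y0 = 2^-1 *: (l0 + l1).
  by rewrite /l0 /l1 scaleNr addrACA subrr addr0 scalerDr -scalerDl half1 scale1r.
have y1E : y1 = (- 'i / 2) *: (l0 - l1).
  rewrite /l0 /l1 scaleNr opprD opprK addrACA subrr add0r -scalerDl scalerA mulrDr mulrAC.
  by rewrite mulNr -expr2 sqrCi opprK mul1r half1 scale1r.
have sE' : s = 'i * ((e0 - e1) / 2).
  by rewrite -sE mulrN mulrA -expr2 sqrCi mulN1r opprK.
have lin p q : p *: l0 + q *: l1 = (p + q) *: y0 + ('i * (p - q)) *: y1.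
  rewrite /l0 /l1 !scalerDr !scalerA addrACA -scalerDl -scalerDl.
  by rewrite mulrN mulrBr (mulrC p) (mulrC q).
clearbody l0 l1; split.
  rewrite [in LHS]y0E -scalemxAr -scalemxAl mulmxDr mulmxDl H0 H1 lin scalerDr !scalerA.
  by rewrite cE sE' mulrC mulrCA (mulrC 2^-1).
rewrite [in LHS]y1E -scalemxAr -scalemxAl mulmxBr mulmxBl H0 H1 -scaleNr lin scalerDr !scalerA.
rewrite cE sE' opprK; congr (_ *: _ + _ *: _).
  by rewrite -mulrA mulNr (mulrC 2^-1).
by rewrite mulrACA mulNr -expr2 sqrCi opprK mul1r mulrC.
Qed.

(** On each pair the conjugation is the plane rotation by 2t, with rows (cos, sin) and (-sin, cos);
    this is e^{2itY} on the internal index. *)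
Lemma heisenberg_pair_evol N (x : 'I_(N * 2) -> op) t : clifford x ->
  heisenberg x (pair_evol x t) (rotmx (t + t) (1%:M *t PY)).
Proof.
move=> xC a; case: (mxtens_indexP a) => i s.
have -> : \sum_b rotmx (t + t) (1%:M *t PY) (mxtens_index (i, s)) b *: x b
  = \sum_(u < 2) rotmx (t + t) PY s u *: x (mxtens_index (i, u)).
  rewrite sum_mxtens (bigD1 i) //= [X in _ + X]big1 ?addr0 => [|j ji].
    by apply: eq_bigr => u _; rewrite rotmx_tens1 tensmxE mxE eqxx mul1r.
  by apply: big1 => u _; rewrite rotmx_tens1 tensmxE mxE eq_sym (negbTE ji) mul0r scale0r.
have [y0 y1] := ladder_solve (ladder_pair_evol_conj xC t false i) (ladder_pair_evol_conj xC t true i)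
  (mulr1 _) (mulrN1 _) (esym (expi_half_sum (t + t))) (esym (expi_half_diff (t + t))).
rewrite big_ord_recl big_ord1 !rotmxE !mxE (_ : lift ord0 ord0 = 1); last exact: val_inj.
have /orP[/eqP->|/eqP->] : (s == 0) || (s == 1) by case: s => [[|[|]]].
  by rewrite y0 mulr1 !mulr0 add0r addr0 mulrN mulrAC -expr2 sqrCi mulN1r opprK.
by rewrite y1 mulr1 !mulr0 add0r addr0 mulrAC -expr2 sqrCi mulN1r.
Qed.
End Clifford.

(** * Pauli strings as Majorana operators; H_0 and H_1 as sums over pairs *)

Section Majorana.
Variables (R : realType) (N : nat).
Local Notation C := R[i].
Local Notation op := 'M[C]_(2 ^ N).
Local Notation g := (@gate1 R (2 ^ N)).
Local Notation Zs := (Zstring R N).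
Let dN : (2 ^ N)%N = (2 ^ N)%N := erefl.

Lemma PY2 : (PY : 'M[C]_2) *m PY = 1%:M.
Proof.
apply/matrixP => i j; rewrite !mxE big_ord_recl big_ord1 !mxE.
by case: i => [[|[|]]] //= ?; case: j => [[|[|]]] //= ?;
  rewrite ?mul0r ?mulr0 ?mulr1 ?addr0 ?add0r ?mulNr ?mulrN -?expr2 ?sqrCi ?opprK.
Qed.

Lemma PXY : (PX : 'M[C]_2) *m PY = 'i *: PZ.
Proof.
apply/matrixP => i j; rewrite !mxE big_ord_recl big_ord1 !mxE.
by case: i => [[|[|]]] //= ?; case: j => [[|[|]]] //= ?;
  rewrite ?mul0r ?mulr0 ?mulr1 ?addr0 ?add0r ?mul1r ?expr1 ?mulrN1.
Qed.

Lemma PYX : (PY : 'M[C]_2) *m PX = - 'i *: PZ.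
Proof.
apply/matrixP => i j; rewrite !mxE big_ord_recl big_ord1 !mxE.
by case: i => [[|[|]]] //= ?; case: j => [[|[|]]] //= ?;
  rewrite ?mul0r ?mulr0 ?mulr1 ?addr0 ?add0r ?mul1r ?expr1 ?mulrN1 ?opprK.
Qed.

Lemma PYZ : (PY : 'M[C]_2) *m PZ = 'i *: PX.
Proof.
apply/matrixP => i j; rewrite !mxE big_ord_recl big_ord1 !mxE.
by case: i => [[|[|]]] //= ?; case: j => [[|[|]]] //= ?;
  rewrite ?mul0r ?mulr0 ?mulr1 ?addr0 ?add0r ?mul1r ?expr1 ?mulrN1 ?opprK.
Qed.

Lemma PZY : (PZ : 'M[C]_2) *m PY = - 'i *: PX.
Proof.
apply/matrixP => i j; rewrite !mxE big_ord_recl big_ord1 !mxE.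
by case: i => [[|[|]]] //= ?; case: j => [[|[|]]] //= ?;
  rewrite ?mul0r ?mulr0 ?mulr1 ?addr0 ?add0r ?mul1r ?expr1 ?mulN1r.
Qed.

Lemma PXZ' : (PX : 'M[C]_2) *m PZ = - 'i *: PY.
Proof.
apply/matrixP => i j; rewrite !mxE big_ord_recl big_ord1 !mxE.
by case: i => [[|[|]]] //= ?; case: j => [[|[|]]] //= ?;
  rewrite ?mul0r ?mulr0 ?mulr1 ?addr0 ?add0r ?mul1r ?expr1 ?mulNr ?mulrN -?expr2 ?sqrCi ?opprK.
Qed.

Lemma PX_tC : (PX : 'M[C]_2) ^t* = PX.
Proof. by apply/matrixP => i j; rewrite !mxE rmorph_nat eq_sym. Qed.

Lemma PY_tC : (PY : 'M[C]_2) ^t* = PY.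
Proof.
apply/matrixP => i j; rewrite !mxE.
by case: i => [[|[|]]] //= ?; case: j => [[|[|]]] //= ?; rewrite ?rmorph0 ?rmorphN /= ?conjCi ?opprK.
Qed.

Lemma PZ_tC : (PZ : 'M[C]_2) ^t* = PZ.
Proof.
apply/matrixP => i j; rewrite !mxE.
by case: i => [[|[|]]] //= ?; case: j => [[|[|]]] //= ?; rewrite ?rmorph0 ?rmorphN ?rmorph1.
Qed.

Definition sigma (s : bool) : 'M[C]_2 := if s then PY else PX.

Lemma sigma2 s : sigma s *m sigma s = 1%:M.
Proof. by case: s; rewrite /sigma ?PY2 ?PX2. Qed.

Lemma sigma_tC s : (sigma s) ^t* = sigma s.
Proof. by case: s; rewrite /sigma ?PY_tC ?PX_tC. Qed.

Lemma sigma_neg s : sigma s *m sigma (~~ s) = - (sigma (~~ s) *m sigma s).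
Proof. by case: s; rewrite /sigma /= PXY PYX ?scaleNr ?opprK. Qed.

Lemma sigmaZ s : PZ *m sigma s = (-1) *: (sigma s *m PZ).
Proof.
rewrite scaleN1r; case: s; rewrite /sigma ?PYZ ?PZY ?scaleNr //.
by rewrite PXZ opprK.
Qed.

Lemma Zstring0 : Zs 0 = 1%:M.
Proof. by rewrite /Zstring big_ord0. Qed.

Lemma ZstringS j : Zs j.+1 = Zs j *m g j PZ.
Proof. by rewrite /Zstring big_ord_recr. Qed.

(** The string meets wire [k] only if [k < j]. One statement serves Z, with sign 1, and X and Y,
    with sign -1. *)
Lemma Zstring_gate1 j k (G : 'M[C]_2) (e : C) : (j <= N)%N -> (k < N)%N ->
  PZ *m G = e *: (G *m PZ) ->
  Zs j *m g k G = (if (k < j)%N then e else 1) *: (g k G *m Zs j).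
Proof.
move=> jN kN ZG; elim: j jN => [|j IH] jN; first by rewrite Zstring0 mul1mx mulmx1 scale1r.
have [kj|jk] := eqVneq k j.
  have := IH (ltnW jN); rewrite kj ltnn ltnSn scale1r => H.
  rewrite ZstringS -mulmxA -(gate1M dN) // ZG gate1Z -scalemxAr (gate1M dN) // !mulmxA.
  by rewrite H.
rewrite ZstringS -mulmxA (gate1_comm dN) //; last by rewrite eq_sym.
rewrite mulmxA (IH (ltnW jN)) -scalemxAl -mulmxA.
by rewrite [in RHS]ltnS [in RHS]leq_eqVlt (negbTE jk).
Qed.

Lemma Zstring_Z j k : (j <= N)%N -> (k < N)%N -> Zs j *m g k PZ = g k PZ *m Zs j.
Proof.
move=> jN kN; rewrite (Zstring_gate1 (e := 1) jN kN) ?scale1r //.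
by case: ifP; rewrite scale1r.
Qed.

Lemma Zstring_sigma j k s : (j <= N)%N -> (k < N)%N ->
  Zs j *m g k (sigma s) = (if (k < j)%N then -1 else 1) *: (g k (sigma s) *m Zs j).
Proof. by move=> jN kN; apply: Zstring_gate1 => //; exact: sigmaZ. Qed.

Lemma Zstring_comm j k : (j <= N)%N -> (k <= N)%N -> Zs j *m Zs k = Zs k *m Zs j.
Proof.
move=> jN; elim: k => [|k IH] kN; first by rewrite Zstring0 mul1mx mulmx1.
by rewrite ZstringS mulmxA (IH (ltnW kN)) -mulmxA Zstring_Z // mulmxA.
Qed.

Lemma Zstring2 j : (j <= N)%N -> Zs j *m Zs j = 1%:M.
Proof.
elim: j => [|j IH] jN; first by rewrite Zstring0 mul1mx.
rewrite ZstringS mulmxA -[Zs j *m _ *m _]mulmxA -(Zstring_Z (ltnW jN) jN) mulmxA (IH (ltnW jN)).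
by rewrite mul1mx -(gate1M dN) // PZ2 (gate1_1 R dN).
Qed.

Lemma Zstring_tC j : (j <= N)%N -> (Zs j) ^t* = Zs j.
Proof.
elim: j => [|j IH] jN; first by rewrite Zstring0 scalar1_tC.
by rewrite ZstringS mulmx_tC (IH (ltnW jN)) gate1_tC PZ_tC Zstring_Z // ltnW.
Qed.

Definition mj (j : nat) (s : bool) : op := Zs j *m g j (sigma s).

Lemma mj_comm j s : (j < N)%N -> mj j s = g j (sigma s) *m Zs j.
Proof. by move=> jN; rewrite /mj Zstring_sigma ?ltnn ?scale1r // ltnW. Qed.

Lemma mj_same j s t : (j < N)%N -> mj j s *m mj j t = g j (sigma s *m sigma t).
Proof.
move=> jN; rewrite (mj_comm s jN) /mj mulmxA -(mulmxA (g j (sigma s))) (Zstring2 (ltnW jN)).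
by rewrite mulmx1 (gate1M dN).
Qed.

(** The operator at [j] commutes with the Pauli matrix on wire [k], but the string of [k] contains
    Z_j: this gives the single sign. *)
Lemma mj_anti j k s t : (j < k)%N -> (k < N)%N -> mj j s *m mj k t = - (mj k t *m mj j s).
Proof.
move=> jk kN; have jN := ltn_trans jk kN.
have jk' : j != k by rewrite ltn_eqF.
have H1 : mj j s *m g k (sigma t) = g k (sigma t) *m mj j s.
  rewrite /mj -mulmxA (gate1_comm dN (sigma s) (sigma t) jN kN jk') mulmxA.
  by rewrite (Zstring_sigma t (ltnW jN) kN) ltnNge (ltnW jk) scale1r mulmxA.
have H2 : Zs k *m mj j s = - (mj j s *m Zs k).
  rewrite /mj mulmxA (Zstring_comm (ltnW kN) (ltnW jN)) -mulmxA (Zstring_sigma s (ltnW kN) jN) jk.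
  by rewrite scaleN1r mulmxN mulmxA.
rewrite {2}(mj_comm t kN) -[g k _ *m Zs k *m _]mulmxA H2 mulmxN opprK.
by rewrite [in LHS](mj_comm t kN) mulmxA H1 -mulmxA.
Qed.

Lemma majorana_mj i (s : 'I_2) : majorana R N (i * 2 + s) = mj i (s != 0).
Proof.
have h : ((i * 2 + s)./2 = i)%N by rewrite -divn2 divnMDl // divn_small ?addn0.
have o : odd (i * 2 + s) = (s != 0) by rewrite oddD oddM andbF; case: s {h} => [[|[|]]].
by rewrite /majorana h o /mj /sigma; case: ifP.
Qed.

Definition maj (a : 'I_(N * 2)) : op := majorana R N a.

Lemma maj_mj i s : maj (mxtens_index (i, s)) = mj i (s != 0).
Proof. exact: majorana_mj. Qed.

Lemma ord2_neq (s t : 'I_2) : (s != t) = ((s != 0) != (t != 0)).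
Proof. by case: s t => [[|[|]]] // ? [[|[|]]]. Qed.

Lemma maj_clifford : clifford maj.
Proof.
split=> [a|a|a b].
- case: (mxtens_indexP a) => i s; rewrite maj_mj [RHS](mj_comm _ (ltn_ord i)) /mj mulmx_tC.
  by rewrite (Zstring_tC (ltnW (ltn_ord i))) gate1_tC sigma_tC.
- by case: (mxtens_indexP a) => i s; rewrite maj_mj mj_same // sigma2 (gate1_1 R dN).
- case: (mxtens_indexP a) => i s; case: (mxtens_indexP b) => j t.
  rewrite (inj_eq (can_inj (@mxtens_indexK N 2))) xpair_eqE negb_and !maj_mj.
  have [->/=|ij _] := eqVneq i j.
    rewrite ord2_neq !mj_same // => st.
    rewrite (_ : (t != 0) = ~~ (s != 0)); last by move: st; do 2!case: (_ != 0).
    by rewrite sigma_neg -scaleN1r gate1Z scaleN1r.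
  move: ij; rewrite neq_ltn => /orP[ij|ji]; first exact: mj_anti.
  by rewrite (mj_anti _ _ ji (ltn_ord i)) opprK.
Qed.

Lemma H0_pair : H0 R N = \sum_(i < N) pair_op maj i.
Proof.
apply: eq_bigr => i _; rewrite /pair_op !maj_mj /= mj_same // /sigma PXY gate1Z scalerA.
by rewrite mulNr -expr2 sqrCi opprK scale1r.
Qed.

Definition maj1 (a : 'I_(N * 2)) : op := maj (ordS a).

Lemma ordS0 (i : 'I_N) : ordS (mxtens_index (i, 0 : 'I_2)) = mxtens_index (i, 1) :> 'I_(N * 2).
Proof.
apply: val_inj; rewrite /= addn0 addn1 modn_small //.
by have := ltn_ord i; lia.
Qed.

Lemma ordS1 (i j : 'I_N) : j = (i.+1 %% N)%N :> nat ->
  ordS (mxtens_index (i, 1 : 'I_2)) = mxtens_index (j, 0) :> 'I_(N * 2).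
Proof.
move=> ij; apply: val_inj; rewrite /= addn0 ij addn1.
by rewrite (_ : (i * 2).+2 = i.+1 * 2)%N ?muln_modl // mulSn.
Qed.

(** Away from the end, the strings of x_{2i+1} and x_{2i+2} leave Y_i Z_i X_{i+1}, and Y Z = i X. At
    the end the full string in [Xper] contributes Z_i, and X_i Z_i = -i Y_i rebuilds x_{2N-1},
    followed by x_0 = X_0. The factor is -i in both cases, so the pairing closes cyclically. *)
Lemma H1_pair : H1 R N = \sum_(i < N) pair_op maj1 i.
Proof.
apply: eq_bigr => i _; rewrite /pair_op /maj1 ordS0 maj_mj.
have iN := ltn_ord i.
have Zall_E : Zall R N = Zs N by [].
have ZN k : k = i.+1 -> Zs k = Zs i *m g i PZ by move=> ->; exact: ZstringS.
have XE : Xper R N i = g i PX by rewrite /Xper ltn_eqF.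
have i' : 'i * 'i = -1 :> C by rewrite -expr2 sqrCi.
have [iN1|iN1] := eqVneq i.+1 N.
  have N0 : (0 < N)%N by rewrite -iN1.
  rewrite (@ordS1 i (Ordinal N0)) /=; last by rewrite iN1 modnn.
  rewrite maj_mj /= XE /Xper iN1 eqxx Zall_E (ZN N (esym iN1)) /mj Zstring0 mul1mx /sigma /=.
  have XZ : g i PX *m Zs i = Zs i *m g i PX.
    by have := Zstring_sigma false (ltnW iN) iN; rewrite ltnn scale1r.
  rewrite mulmxA (mulmxA (g i PX)) XZ -(mulmxA (Zs i)) -(gate1M dN) // PXZ' gate1Z.
  by rewrite -scalemxAr -scalemxAl.
have i1N : (i.+1 < N)%N by rewrite ltn_neqAle iN1.
rewrite (@ordS1 i (Ordinal i1N)) /=; last by rewrite modn_small.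
rewrite maj_mj /= XE /Xper (negbTE iN1) /mj ZstringS /sigma /=.
have YZ : Zs i *m g i PY = g i PY *m Zs i.
  by have := Zstring_sigma true (ltnW iN) iN; rewrite ltnn scale1r.
rewrite YZ !mulmxA -(mulmxA (g i PY)) (Zstring2 (ltnW iN)) mulmx1 -(gate1M dN) // PYZ gate1Z.
by rewrite -scalemxAl scalerA mulNr i' opprK scale1r.
Qed.
End Majorana.

(** * The compressed register *)

Section Shift.
Variables (R : realType) (m : nat).
Local Notation C := R[i].
Local Notation op := 'M[C]_(2 ^ m * 2).
Local Notation A := (A R m).

Lemma AE i j : A i j = (i == ordS j)%:R.
Proof.
rewrite /A summxE (bigD1 j) //= big1 ?addr0 => [|k kj]; first by rewrite mxE eqxx andbT.
by rewrite mxE [j == k]eq_sym (negbTE kj) andbF.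
Qed.

Lemma A_tC_tr : A ^t* = A^T.
Proof. by apply/matrixP => i j; rewrite !mxE !AE rmorph_nat. Qed.

Lemma mulA_mx p (M : 'M[C]_(2 ^ m * 2, p)) i j : (A *m M) i j = M (ord_pred i) j.
Proof.
rewrite mxE (bigD1 (ord_pred i)) //= AE ord_predK eqxx mul1r big1 ?addr0 // => k ki.
rewrite AE (negbTE (_ : i != ordS k)) ?mul0r //.
by apply: contra ki => /eqP ->; rewrite ordSK.
Qed.

Lemma mulAT_mx p (M : 'M[C]_(2 ^ m * 2, p)) i j : (A^T *m M) i j = M (ordS i) j.
Proof.
rewrite mxE (bigD1 (ordS i)) //= mxE AE eqxx mul1r big1 ?addr0 // => k ki.
by rewrite mxE AE (negbTE ki) mul0r.
Qed.

Lemma mul_mxAT p (M : 'M[C]_(p, 2 ^ m * 2)) i j : (M *m A^T) i j = M i (ord_pred j).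
Proof. by rewrite -[M]trmxK -trmx_mul mxE mulA_mx !mxE. Qed.

Lemma A_unitary : A \is unitarymx.
Proof.
apply/unitarymxP/matrixP => i j; rewrite A_tC_tr mulA_mx mxE AE ord_predK.
by rewrite mxE eq_sym.
Qed.

Lemma A_tCK : A ^t* *m A = 1%:M.
Proof. exact: (unitarymx_tCK A_unitary). Qed.

(** Renaming each index to its successor is the action of [A] on basis vectors, so the coefficient
    matrix is conjugated by [A]. This carries the result for the first pairing over to the
    second. *)
Lemma heisenberg_shift D (x : 'I_(2 ^ m * 2) -> 'M[C]_D) (U : 'M[C]_D) (Q : op) :
  heisenberg (x \o @ordS _) U Q -> heisenberg x U (A *m Q *m A ^t*).
Proof.
move=> h a; rewrite -{1}(ord_predK a) h [RHS](reindex (@ordS _)) /=; last first.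
  by exists (@ord_pred _) => b _; rewrite ?ordSK ?ord_predK.
apply: eq_bigr => b _; congr (_ *: _).
by rewrite A_tC_tr mul_mxAT mulA_mx ordSK.
Qed.

Lemma PY_tr : (PY : 'M[C]_2)^T = - PY.
Proof.
apply/matrixP => i j; rewrite !mxE.
by case: i => [[|[|]]] //= ?; case: j => [[|[|]]] //= ?; rewrite ?oppr0 ?opprK.
Qed.

Lemma on_lastM (G H : 'M[C]_2) : on_last m (G *m H) = on_last m G *m on_last m H.
Proof. by rewrite /on_last tensmx_mul mul1mx. Qed.

Lemma tens1 p q : (1%:M : 'M[C]_p) *t (1%:M : 'M[C]_q) = 1%:M.
Proof.
apply/matrixP => a b; case: (mxtens_indexP a) => i s; case: (mxtens_indexP b) => j u.
rewrite tensmxE !mxE (inj_eq (can_inj (@mxtens_indexK p q))) xpair_eqE.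
by rewrite -natrM mulnb.
Qed.

Lemma tens_tC p q r s (M : 'M[C]_(p, q)) (N : 'M[C]_(r, s)) : (M *t N) ^t* = M ^t* *t N ^t*.
Proof. by rewrite trmx_tens map_mxT. Qed.

Lemma on_last1 : on_last m 1%:M = 1%:M :> op.
Proof. exact: tens1. Qed.

Lemma on_last_tC (G : 'M[C]_2) : (on_last m G) ^t* = on_last m (G ^t*).
Proof. by rewrite /on_last tens_tC scalar1_tC. Qed.

Lemma on_last_unitary (G : 'M[C]_2) : G \is unitarymx -> on_last m G \is unitarymx.
Proof.
by move=> /unitarymxP G1; apply/unitarymxP; rewrite on_last_tC -on_lastM G1 on_last1.
Qed.

Lemma on_last_rotmx t (P : 'M[C]_2) : on_last m (rotmx t P) = rotmx t (on_last m P).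
Proof. by rewrite /on_last rotmx_tens1. Qed.

Lemma Ym2 : Ym R m *m Ym R m = 1%:M.
Proof. by rewrite /Ym -on_lastM PY2 on_last1. Qed.

Lemma on_last_tr (G : 'M[C]_2) : (on_last m G)^T = on_last m G^T.
Proof. by rewrite /on_last trmx_tens tr_scalar_mx. Qed.

Lemma AYA2 : (A *m Ym R m *m A ^t*) *m (A *m Ym R m *m A ^t*) = 1%:M.
Proof.
rewrite !mulmxA -(mulmxA (A *m Ym R m)) A_tCK mulmx1 -(mulmxA A) Ym2 mulmx1.
exact/unitarymxP/A_unitary.
Qed.

Section Evolution.
Variables (L : nat) (T B J : R).
Local Notation Del := (Delta L T).
Local Notation phi l := (J * (l%:R / L%:R) * Del).

Lemma expmx_involE n (P : 'M[C]_n) (c : C) (t : R) :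
  P *m P = 1%:M -> c = 'i * t%:C -> expmx (c *: P) = rotmx t P.
Proof. by move=> PP ->; exact: expmx_invol. Qed.

Lemma double_half (F : numFieldType) (a b : F) : - (2%:R * a) * (- b / 2%:R) = b * a.
Proof. by field. Qed.

Lemma quarter_turn (x : R) : (- (4%:R * x))%:C * (- 'i / 2%:R) = 'i * (x + x)%:C.
Proof.
have -> : 4%:R * x = 2%:R * (x + x) by ring.
by rewrite rmorphN rmorphM rmorph_nat; exact: double_half.
Qed.

Lemma R0E : R0 m L T B = rotmx (B * Del + B * Del) (Ym R m).
Proof. by rewrite /R0 /h0 scalerA; apply: (expmx_involE Ym2); rewrite -mulrA quarter_turn. Qed.

Lemma R1E l : R1 m L T J l = rotmx (phi l + phi l) (A *m Ym R m *m A ^t*).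
Proof.
rewrite /R1 /h1 /h0 -scalemxAr -scalemxAl scalerA; apply: (expmx_involE AYA2).
by rewrite -!(mulrA 4%:R) quarter_turn.
Qed.

Lemma R1E' l : R1 m L T J l = A *m on_last m (rotmx (phi l + phi l) PY) *m A ^t*.
Proof.
rewrite R1E on_last_rotmx; apply: rotmx_conj; exact/unitarymxP/A_unitary.
Qed.

Lemma S0E : S0 L T B = rotmx (- (B * Del + B * Del)) PY.
Proof.
apply: (expmx_involE (PY2 R)); rewrite mulNr -mulrN -rmorphN; congr ('i * _%:C).
by rewrite -mulrA; congr (- _); ring.
Qed.

Lemma JtauE l : J * tau L T l = phi l + phi l.
Proof. by rewrite /tau; ring. Qed.

Lemma S1E l : S1 L T J l = rotmx (- (phi l + phi l)) PY.
Proof.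
by apply: (expmx_involE (PY2 R)); rewrite mulNr -mulrN -rmorphN JtauE.
Qed.

Lemma tr_R0 : (R0 m L T B)^T = on_last m (S0 L T B).
Proof. by rewrite R0E S0E /Ym -on_last_rotmx on_last_tr tr_rotmx PY_tr rotmxN. Qed.

Lemma tr_R1 l : (R1 m L T J l)^T = A *m on_last m (S1 L T J l) *m A ^t*.
Proof.
rewrite R1E' !trmx_mul on_last_tr tr_rotmx PY_tr rotmxN -S1E A_tC_tr trmxK mulmxA.
by [].
Qed.

Lemma tr_step l : (R0 m L T B *m R1 m L T J l)^T
  = A *m on_last m (S1 L T J l) *m A ^t* *m on_last m (S0 L T B).
Proof. exact: etrans (trmx_mul _ _) (congr2 mulmx (tr_R1 l) tr_R0). Qed.

(** Transposition reverses the factors and so undoes [rev_ord]: the step l = 0 ends up leftmost, as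
    in [psi_out]. *)
Lemma trmx_prod_rev n k (F : nat -> 'M[C]_k) :
  (\prod_(l < n) F (rev_ord l))^T = \prod_(l < n) (F l)^T.
Proof.
elim: n => [|n IH]; first by rewrite !big_ord0 tr_scalar_mx.
by rewrite big_ord_recl big_ord_recr /= trmx_mul subn1 /= -IH; congr (_^T *m _).
Qed.

Lemma tr_Rot : (Rot m L T B J)^T = \prod_(l < L.+1) (R0 m L T B *m R1 m L T J l)^T.
Proof. exact: (trmx_prod_rev _ (fun l => R0 m L T B *m R1 m L T J l)). Qed.

End Evolution.

Definition reindex_aux (k : 'I_(2 ^ m)) (s u : 'I_2) : 'I_(2 ^ m * 2 * 2) :=
  mxtens_index (mxtens_index (k, s), u).

Lemma on_last_auxE G (k k' : 'I_(2 ^ m)) (s u s' u' : 'I_2) :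
  on_last_aux m G (reindex_aux k s u) (reindex_aux k' s' u')
  = (k == k')%:R * G (mxtens_index (s, u)) (mxtens_index (s', u')) :> C.
Proof.
rewrite /on_last_aux castmxE.
(* Both groupings of the tensor factors number the entry 4 j + 2 t + v. *)
have ce e (j : 'I_(2 ^ m)) (t v : 'I_2) : cast_ord (esym e) (reindex_aux j t v)
    = mxtens_index (j, mxtens_index (t, v)) :> 'I_(2 ^ m * (2 * 2)).
  by apply: val_inj => /=; lia.
by rewrite !ce tensmxE mxE.
Qed.

Lemma aux_matrixP (M N : 'M[C]_(2 ^ m * 2 * 2)) :
  (forall k s u k' s' u', M (reindex_aux k s u) (reindex_aux k' s' u')
     = N (reindex_aux k s u) (reindex_aux k' s' u')) -> M = N.
Proof.
move=> H; apply/matrixP => i j.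
case: (mxtens_indexP i) => i1 u; case: (mxtens_indexP i1) => k s.
by case: (mxtens_indexP j) => j1 u'; case: (mxtens_indexP j1) => k' s'; exact: H.
Qed.

Lemma on_last_aux_tens (P Q : 'M[C]_2) : on_last_aux m (P *t Q) = on_last m P *t Q.
Proof.
apply: aux_matrixP => k s u k' s' u'.
by rewrite on_last_auxE !tensmxE mxE mulrA.
Qed.

Lemma on_last_auxM G H : on_last_aux m (G *m H) = on_last_aux m G *m on_last_aux m H :> 'M[C]_(2 ^ m * 2 * 2).
Proof.
rewrite /on_last_aux -{1}(mulmx1 (1%:M : 'M[C]_(2 ^ m))) -tensmx_mul.
by case: _ / (mulnA _ _ _).
Qed.

Lemma on_last_auxD G H : on_last_aux m (G + H) = on_last_aux m G + on_last_aux m H :> 'M[C]_(2 ^ m * 2 * 2).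
Proof.
by apply: aux_matrixP => k s u k' s' u'; rewrite [RHS]mxE !on_last_auxE mxE mulrDr.
Qed.

Lemma on_last_auxZ a G : on_last_aux m (a *: G) = a *: on_last_aux m G :> 'M[C]_(2 ^ m * 2 * 2).
Proof.
by apply: aux_matrixP => k s u k' s' u'; rewrite [RHS]mxE !on_last_auxE mxE mulrCA.
Qed.

Lemma on_last_aux1 : on_last_aux m 1%:M = 1%:M :> 'M[C]_(2 ^ m * 2 * 2).
Proof. by rewrite -tens1 on_last_aux_tens on_last1 tens1. Qed.

Lemma with_aux_tC (M : op) : (with_aux M) ^t* = with_aux (M ^t*).
Proof. by rewrite /with_aux tens_tC scalar1_tC. Qed.

Lemma with_aux_unitary (M : op) : M \is unitarymx -> with_aux M \is unitarymx.
Proof.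
move=> /unitarymxP M1; apply/unitarymxP.
by rewrite with_aux_tC /with_aux tensmx_mul M1 mulmx1 tens1.
Qed.

Lemma Htilde_tC : (Htilde R) ^t* = Htilde R.
Proof.
by rewrite /Htilde linearZ /= map_mxZ linearD /= map_mxD PX_tC PY_tC conj_invsqrt2.
Qed.

Lemma PXY_anti : (PX : 'M[C]_2) *m PY = - (PY *m PX).
Proof. by rewrite PXY PYX scaleNr opprK. Qed.

Lemma Htilde2 : Htilde R *m Htilde R = 1%:M.
Proof. exact: (mul_hadamard (PX2 R) (PY2 R) PXY_anti). Qed.

Lemma HtildeX : Htilde R *m PX *m Htilde R = PY.
Proof. exact: (conj_hadamard (PX2 R) (PY2 R) PXY_anti). Qed.

Lemma Htilde_unitary : Htilde R \is unitarymx.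
Proof. by apply/unitarymxP; rewrite Htilde_tC Htilde2. Qed.

Lemma PXX2 : ((PX : 'M[C]_2) *t (PX : 'M[C]_2)) *m (PX *t PX) = 1%:M.
Proof. by rewrite tensmx_mul PX2 tens1. Qed.

Lemma S1tildeE L T J l :
  S1tilde L T J l = rotmx (- (J * tau L T l)) ((PY : 'M[C]_2) *t (PX : 'M[C]_2)).
Proof.
rewrite /S1tilde /ising (_ : expmx _ = rotmx (- (J * tau L T l)) (PX *t PX)); last first.
  by apply: (expmx_involE PXX2); rewrite mulNr -mulrN -rmorphN.
rewrite -rotmx_conj; last by rewrite tensmx_mul Htilde2 mulmx1 tens1.
by rewrite !tensmx_mul mul1mx mulmx1 HtildeX.
Qed.

Lemma PX_plus : PX *m plus R = plus R.
Proof.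
apply/matrixP => i j; rewrite !mxE big_ord_recl big_ord1 !mxE.
by case: i => [[|[|]]] //= ?; rewrite ?mul0r ?mul1r ?add0r ?addr0.
Qed.

Lemma with_aux_plus (M : op) (v : 'cV[C]_(2 ^ m * 2)) :
  with_aux M *m (v *t plus R) = (M *m v) *t plus R.
Proof. by rewrite /with_aux tensmx_mul mul1mx. Qed.

(** [plus] is fixed by X, so P ⊗ X acts on it as P alone. In [S1tildeE] the conjugation by [Htilde]
    has turned X ⊗ X into Y ⊗ X; on [plus] the two-qubit gate therefore acts as [S1]. *)
Lemma on_last_aux_plus (P : 'M[C]_2) (v : 'cV[C]_(2 ^ m * 2)) t :
  on_last_aux m (rotmx t (P *t PX)) *m (v *t plus R) = (on_last m (rotmx t P) *m v) *t plus R.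
Proof.
rewrite [in LHS]/rotmx -scalemx1 on_last_auxD !on_last_auxZ on_last_aux1 on_last_aux_tens.
rewrite mulmxDl -!scalemxAl mul1mx tensmx_mul PX_plus on_last_rotmx /rotmx mulmxDl mul_scalar_mx -scalemxAl.
by apply/matrixP => i j; rewrite !mxE !mulrDl !mulrA.
Qed.

Lemma Vtilde_plus L T B J l (v : 'cV[C]_(2 ^ m * 2)) :
  Vtilde m L T B J l *m (v *t plus R) = ((R0 m L T B *m R1 m L T J l)^T *m v) *t plus R.
Proof.
rewrite tr_step S1E /Vtilde S1tildeE (JtauE L T J l) -!mulmxA.
by rewrite with_aux_plus with_aux_plus on_last_aux_plus with_aux_plus.
Qed.

Lemma psi_outE L T B J :
  ((Rot m L T B J)^T *m Phi R m) *t plus R = psi_out m L T B J.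
Proof.
rewrite tr_Rot /psi_out; elim: (index_enum _) => [|l r IH].
  by rewrite !big_nil !mul1mx.
by rewrite !big_cons -[RHS]mulmxA -IH Vtilde_plus mulmxA.
Qed.

End Shift.

(** * The mode occupation *)

Section Vacuum.
Variables (R : realType) (N : nat).
Local Notation C := R[i].
Local Notation g := (@gate1 R (2 ^ N)).
Let dN : (2 ^ N)%N = (2 ^ N)%N := erefl.
Local Notation vac := (ket0 R N).

Lemma gate1_PZ_vac j : (j < N)%N -> g j PZ *m vac = vac.
Proof.
move=> jN; apply/matrixP => i k; rewrite PZ_diag2 (gate1_diag2 dN) // mul_dgmx !mxE.
by case: eqP => [->|]; rewrite ?mulr0 // /qbit div0n mulr1.
Qed.

Lemma Zstring_vac j : (j <= N)%N -> Zstring R N j *m vac = vac.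
Proof.
elim: j => [|j IH] jN; first by rewrite Zstring0 mul1mx.
by rewrite ZstringS -mulmxA gate1_PZ_vac // IH // ltnW.
Qed.

Definition excited (j : nat) : 'cV[C]_(2 ^ N) := \col_k (k == 2 ^ j :> nat)%N%:R.

Lemma gate1_PX_vac j : (j < N)%N -> g j PX *m vac = excited j.
Proof.
move=> jN; apply/matrixP => i k; rewrite (gate1_PX R _ jN) mxE (bigD1 (Ordinal (pow2_gt0 N))) //=.
rewrite !mxE eqxx mulr1 big1 ?addr0 => [|l l0].
  by rewrite /flip /setbit /qbit !div0n mod0n mul0n mul1n addn0.
by rewrite [X in _ * X]mxE -val_eqE /= in l0 *; rewrite (negbTE l0) mulr0.
Qed.

Lemma gate1_PY_vac j : (j < N)%N -> g j PY *m vac = 'i *: excited j.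
Proof.
move=> jN; have -> : PY = 'i *: (PX *m PZ) :> 'M[C]_2.
  by rewrite PXZ' scalerA mulrN -expr2 sqrCi opprK scale1r.
by rewrite gate1Z (gate1M dN PX PZ jN) -scalemxAl -mulmxA (gate1_PZ_vac jN) (gate1_PX_vac jN).
Qed.

(** Z fixes the vacuum, so the string disappears and Y = i X Z acts as i X: the two Majorana
    operators of a site create the same state up to the phase i. *)
Lemma maj_vac (k : 'I_N) (s : 'I_2) :
  maj R (mxtens_index (k, s)) *m vac = (if s == 0 then 1 else 'i) *: excited k.
Proof.
rewrite maj_mj (mj_comm _ _ (ltn_ord k)) -mulmxA (Zstring_vac (ltnW (ltn_ord k))) /sigma.
by case: (s == 0); rewrite /= ?scale1r ?gate1_PX_vac ?gate1_PY_vac.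
Qed.

Lemma excited_orthonormal (j k : 'I_N) : (excited j) ^t* *m excited k = (j == k)%:R%:M.
Proof.
have jN : (2 ^ j < 2 ^ N)%N by rewrite ltn_exp2l.
apply/matrixP => a b; rewrite mxE (bigD1 (Ordinal jN)) //= big1 ?addr0 => [|l lj].
  by rewrite !mxE eqxx rmorph1 mul1r eqn_exp2l // !ord1.
by rewrite !mxE -val_eqE /= in lj *; rewrite (negbTE lj) rmorph0 mul0r.
Qed.

Lemma maj_sum_vac (w : 'cV[C]_(N * 2)) :
  (\sum_a w a 0 *: maj R a) *m vac
  = \sum_(k < N) (w (mxtens_index (k, 0)) 0 + 'i * w (mxtens_index (k, 1)) 0) *: excited k.
Proof.
rewrite sum_mxtens mulmx_suml; apply: eq_bigr => k _.
rewrite big_ord_recl big_ord1 (_ : lift ord0 ord0 = 1); last exact: val_inj.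
by rewrite mulmxDl -!scalemxAl !maj_vac /= !scalerA mulr1 scalerDl mulrC.
Qed.

Lemma norm_excited (z : 'I_N -> C) :
  ((\sum_k z k *: excited k) ^t* *m (\sum_k z k *: excited k)) 0 0 = \sum_k (z k)^* * z k.
Proof.
have -> : (\sum_k z k *: excited k) ^t* = \sum_k (z k)^* *: (excited k) ^t*.
  by rewrite linear_sum map_mx_sum; apply: eq_bigr => k _; rewrite linearZ map_mxZ.
rewrite mulmx_suml summxE; apply: eq_bigr => j _.
rewrite mulmx_sumr summxE (bigD1 j) //= big1 ?addr0 => [|k kj].
  by rewrite -scalemxAl -scalemxAr excited_orthonormal !mxE !eqxx mulr1.
by rewrite -scalemxAl -scalemxAr excited_orthonormal !mxE eq_sym (negbTE kj) mul0rn !mulr0.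
Qed.

Lemma mul_conj_pair (F : fieldType) (i a b c d : F) : i * i = -1 ->
  (a - i * b) * (c + i * d) = (a * c + b * d) - (a * (- i * d) + b * (i * c)).
Proof.
move=> ii; apply/eqP; rewrite -subr_eq0.
have -> : (a - i * b) * (c + i * d) - (a * c + b * d - (a * (- i * d) + b * (i * c)))
   = - ((i * i + 1) * (b * d)) by ring.
by rewrite ii addNr mul0r oppr0.
Qed.

(** By orthonormality of the [excited k], site k contributes |w_{2k} + i w_{2k+1}|^2. The squares
    give the norm of [w], and the cross terms are minus the form of Y. *)
Lemma norm_maj_sum (w : 'cV[C]_(N * 2)) :
  (((\sum_a w a 0 *: maj R a) *m vac) ^t* *m ((\sum_a w a 0 *: maj R a) *m vac)) 0 0
  = (w ^t* *m w) 0 0 - (w ^t* *m ((1%:M *t PY) *m w)) 0 0.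
Proof.
rewrite maj_sum_vac norm_excited !mxE !sum_mxtens -sumrB; apply: eq_bigr => k _.
have l1 : lift ord0 ord0 = 1 :> 'I_2 by apply: val_inj.
have Yw s : ((1%:M *t PY) *m w) (mxtens_index (k, s)) 0 =
    \sum_(u < 2) PY s u * w (mxtens_index (k, u)) 0.
  rewrite mxE sum_mxtens (bigD1 k) //= [X in _ + X]big1 ?addr0 => [|j jk].
    by apply: eq_bigr => u _; rewrite tensmxE mxE eqxx mul1r.
  by apply: big1 => u _; rewrite tensmxE mxE eq_sym (negbTE jk) !mul0r.
rewrite !big_ord_recl !big_ord0 !addr0 !Yw !big_ord_recl !big_ord0 !addr0 l1 !mxE /=.
rewrite mul0r mul0r add0r addr0 rmorphD rmorphM /= conjCi mulNr.
by apply: mul_conj_pair; rewrite -expr2 sqrCi.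
Qed.
End Vacuum.

Lemma mul_conj_traceless (F : fieldType) (i r a b c d : F) : i * i = -1 -> a + d = 0 ->
  r * (a * r + c * (i * r)) + - i * r * (b * r + d * (i * r))
  = - (r * (a * r + b * (i * r)) + - i * r * (c * r + d * (i * r))).
Proof.
move=> ii ad; apply/eqP; rewrite -subr_eq0.
set x := (X in X == 0); have -> : x = (1 + 1) * r * r * (a - i * i * d) by rewrite /x; ring.
by rewrite ii mulN1r opprK ad mulr0.
Qed.

(** * A momentum mode as an embedding of C^2 *)

Section FourierMode.
Variables (R : realType) (n : nat).
Local Notation C := R[i].

(** The map eta |-> psi ⊗ eta as a matrix V. A relation W V = V q then says that W preserves the
    mode and acts on its internal state by the 2 by 2 matrix q. *)
Definition lift_mode (psi : 'cV[C]_n) : 'M[C]_(n * 2, 2) :=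
  \matrix_(a, u) (psi (mxtens_unindex a).1 0 * ((mxtens_unindex a).2 == u)%:R).

Lemma lift_modeE psi k s u : lift_mode psi (mxtens_index (k, s)) u = psi k 0 * (s == u)%:R.
Proof. by rewrite mxE mxtens_indexK. Qed.

Lemma lift_mode_mul psi p (M : 'M[C]_(2, p)) k s u :
  (lift_mode psi *m M) (mxtens_index (k, s)) u = psi k 0 * M s u.
Proof.
rewrite mxE (bigD1 s) //= lift_modeE eqxx mulr1 big1 ?addr0 // => v vs.
by rewrite lift_modeE eq_sym (negbTE vs) mulr0 mul0r.
Qed.

Lemma lift_mode_tens (psi : 'cV[C]_n) (eta : 'cV[C]_2) : psi *t eta = lift_mode psi *m eta :> 'cV[C]_(n * 2).
Proof.
apply/matrixP => a j; case: (mxtens_indexP a) => k s; rewrite lift_mode_mul mxE mxtens_indexK.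
by congr (psi k _ * eta s _); apply: val_inj; case: j => [[|]].
Qed.

Lemma mul_tens_lift_mode (G : 'M[C]_2) psi : (1%:M *t G) *m lift_mode psi = lift_mode psi *m G.
Proof.
apply/matrixP => a u; case: (mxtens_indexP a) => k s; rewrite lift_mode_mul.
rewrite mxE sum_mxtens (bigD1 k) //= [X in _ + X]big1 ?addr0 => [|j jk].
  rewrite (bigD1 u) //= big1 ?addr0 => [|v vu].
    by rewrite tensmxE lift_modeE mxE !eqxx mul1r mulr1 mulrC.
  by rewrite lift_modeE (negbTE vu) !mulr0.
by apply: big1 => v _; rewrite tensmxE mxE eq_sym (negbTE jk) !mul0r.
Qed.

Lemma lift_mode_tCK psi : psi ^t* *m psi = 1%:M -> (lift_mode psi) ^t* *m lift_mode psi = 1%:M.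
Proof.
move=> psi1; apply/matrixP => u v; rewrite mxE sum_mxtens exchange_big (bigD1 u) //=.
rewrite [X in _ + X]big1 ?addr0 => [|s su].
  have := congr1 (fun M : 'M[C]_1 => M 0 0) psi1; rewrite mxE [X in _ = X]mxE eqxx mulr1n => psi1'.
  transitivity ((\sum_j (psi ^t*) 0 j * psi j 0) * (u == v)%:R).
    rewrite mulr_suml.
    by apply: eq_bigr => k _; rewrite lift_modeE !mxE mxtens_indexK /= eqxx mulr1 mulrA.
  by rewrite psi1' mul1r [RHS]mxE.
by apply: big1 => k _; rewrite !mxE mxtens_indexK /= (negbTE su) mulr0 rmorph0 mul0r.
Qed.

Lemma lift_mode_conj psi : map_mx Num.conj (lift_mode psi) = lift_mode (map_mx Num.conj psi).
Proof. by apply/matrixP => a u; rewrite !mxE rmorphM rmorph_nat. Qed.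

(* The two amplitudes 1 and i of plus_y turn the form x^* K x into a difference of off-diagonal
   entries, which changes sign under K |-> conj K; the diagonal drops out since K is traceless. *)
Lemma plus_y_form (K : 'M[C]_2) : K ^t* = K -> \tr K = 0 ->
  ((plus_y R) ^t* *m (map_mx Num.conj K *m plus_y R)) 0 0
  = - ((plus_y R) ^t* *m (K *m plus_y R)) 0 0.
Proof.
move=> Kh; rewrite /mxtrace big_ord_recl big_ord1 => Kt.
have l1 : lift ord0 ord0 = 1 :> 'I_2 by apply: val_inj.
have Kc i j : (K i j)^* = K j i by rewrite -[in RHS]Kh !mxE.
rewrite !mxE !big_ord_recl !big_ord0 !mxE !big_ord_recl !big_ord0 !mxE !l1 !Kc /=.
rewrite l1 in Kt.
rewrite rmorphM /= conj_invsqrt2 conjCi !addr0.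
by apply: mul_conj_traceless Kt; rewrite -expr2 sqrCi.
Qed.
End FourierMode.

Lemma intertwine4 (F : pzRingType) n p (M M' O1 O0 : 'M[F]_n) (W : 'M[F]_(n, p)) (a a' s1 s0 : 'M[F]_p) :
  M *m W = W *m a' -> M' *m W = W *m a -> O1 *m W = W *m s1 -> O0 *m W = W *m s0 ->
  M *m O1 *m M' *m O0 *m W = W *m (a' *m s1 *m a *m s0).
Proof.
move=> h h' h1 h0; rewrite -[LHS]mulmxA h0 mulmxA -[X in X *m s0]mulmxA h' mulmxA.
by rewrite -[X in X *m a *m s0]mulmxA h1 mulmxA h !mulmxA.
Qed.

Lemma map_mx_fix4 (F : pzRingType) (f : {rmorphism F -> F}) n (M1 M2 M3 M4 : 'M[F]_n) :
  map_mx f M1 = M1 -> map_mx f M2 = M2 -> map_mx f M3 = M3 -> map_mx f M4 = M4 ->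
  map_mx f (M1 *m M2 *m M3 *m M4) = M1 *m M2 *m M3 *m M4.
Proof. by move=> e1 e2 e3 e4; rewrite !map_mxM e1 e2 e3 e4. Qed.

Lemma PY_conj (R : realType) i j : (PY i j)^* = - PY i j :> R[i].
Proof.
rewrite mxE; case: (i == j); first by rewrite rmorph0 oppr0.
by case: (i == 0); rewrite ?rmorphN /= ?conjCi.
Qed.

(** * Plane waves and the action of A and of R^T on them *)

Section Phases.
Variables (R : realType) (m : nat).
Local Notation C := R[i].
Local Notation N := (2 ^ m)%N.

Lemma expi_add2pi (x : R) : expi (x + 2%:R * pi) = expi x.
Proof. by rewrite /expi mulr_natl cosD2pi sinD2pi. Qed.

Lemma modn_bit t k : (k %% 2 ^ t.+1 = qbit t k * 2 ^ t + k %% 2 ^ t)%N.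
Proof.
rewrite {1}(bit_decomp t k) modnMDl modn_small //.
have : (k %% 2 ^ t < 2 ^ t)%N by rewrite ltn_mod pow2_gt0.
by rewrite expnS; case: (qbit t k); lia.
Qed.

Lemma prod_expi_bits (c : R) n k :
  \prod_(l < n) (if qbit l k then expi (c * 2%:R ^+ l) else 1) = expi (c * (k %% 2 ^ n)%:R).
Proof.
elim: n => [|n IH]; first by rewrite big_ord0 expn0 modn1 mulr0 expi0.
rewrite big_ord_recr /= IH modn_bit; case: (qbit n k); last by rewrite mul0n add0n mulr1.
by rewrite mul1n natrD natrX mulrDr expiD mulrC.
Qed.

Definition omega_pow (k : nat) : C := expi (2%:R * pi * k%:R / N%:R).

(** The angles 2 pi 2^l / N of the qubits with digit 1 add up along the binary expansion of [k], so
    the product state is a plane wave. *)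
Lemma phase_stateE k j : phase_state R m k j = (sqrtC N%:R)^-1 * omega_pow k.
Proof.
rewrite mxE big_split /= prodr_const card_ord exprVn mulrC; congr (_ * _).
  by congr (_^-1); rewrite natrX rootCX ?ler0n.
rewrite /omega_pow; transitivity (expi (2%:R * pi / N%:R * (k %% 2 ^ m)%:R) : C).
  rewrite -prod_expi_bits; apply: eq_bigr => l _; case: ifP => // _; congr expi.
  by rewrite natrX mulrA mulrAC.
by rewrite modn_small // mulrAC.
Qed.

Lemma omega_powS (k : nat) : (k < N)%N ->
  omega_pow (k.+1 %% N) = omega_pow k * expi (2%:R * pi / N%:R).
Proof.
move=> kN; rewrite /omega_pow -expiD.
have N0 : (N%:R : R) != 0 by rewrite pnatr_eq0 -lt0n pow2_gt0.
have -> : 2%:R * pi * k%:R / N%:R + 2%:R * pi / N%:R = 2%:R * pi * k.+1%:R / N%:R :> R.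
  by rewrite -mulrDl -[k.+1%:R]natr1 [in RHS](mulrDr (2%:R * pi)) mulr1.
have [kN1|kN1] := eqVneq k.+1 N; last by rewrite modn_small // ltn_neqAle kN1.
(* At k + 1 = N the index wraps to 0 and the angle is a full turn. *)
rewrite kN1 modnn mulr0 mul0r mulfK // -[in RHS](add0r (2%:R * pi)).
by rewrite expi_add2pi.
Qed.

Lemma omega_powE k : (omega_pow k)^* = expi (- (2%:R * pi * k%:R / N%:R)).
Proof. exact: conj_expi. Qed.

Lemma omega_norm k : (omega_pow k)^* * omega_pow k = 1.
Proof. by rewrite omega_powE -expiD addNr expi0. Qed.

Lemma invsqrtN_conj : ((sqrtC N%:R : C)^-1)^* = (sqrtC N%:R)^-1.
Proof.
by rewrite fmorphV /=; congr (_^-1); apply: CrealP; rewrite ger0_real // sqrtC_ge0 ler0n.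
Qed.

Lemma phase_state_norm : (phase_state R m) ^t* *m phase_state R m = 1%:M.
Proof.
apply/matrixP => a b; rewrite mxE; transitivity (\sum_(k < N) (N%:R : C)^-1).
  apply: eq_bigr => k _; rewrite [(_ ^t*) _ _]mxE [(_^T) _ _]mxE !phase_stateE rmorphM.
  by rewrite /= invsqrtN_conj mulrACA omega_norm mulr1 -invfM -expr2 sqrtCK.
rewrite sumr_const card_ord -[LHS]mulr_natr mulVf ?pnatr_eq0 -?lt0n ?pow2_gt0 //.
by rewrite mxE !ord1 eqxx.
Qed.

Local Notation E := (lift_mode (phase_state R m)).
Local Notation A := (A R m).

(** [A] sends (k, 0) to (k, 1) and (k, 1) to (k + 1, 0). Its adjoint thus exchanges the internal
    states and, in one of the two cases, also translates the plane wave by one site, which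
    multiplies it by [w]. *)
Lemma A_lift_mode : exists a : 'M[C]_2, A *m E = E *m a ^t* /\ A ^t* *m E = E *m a.
Proof.
pose w : C := expi (2%:R * pi / N%:R).
pose a : 'M[C]_2 := \matrix_(s, u) (if s == 0 then (u == 1)%:R else w * (u == 0)%:R).
have ww : w * w^* = 1 by rewrite conj_expi -expiD subrr expi0.
have AE : A ^t* *m E = E *m a.
  apply/matrixP => i u; case: (mxtens_indexP i) => k s; rewrite A_tC_tr mulAT_mx lift_mode_mul [a _ _]mxE.
  have /orP[/eqP->|/eqP->] : (s == 0) || (s == 1) by case: s => [[|[|]]].
    by rewrite ordS0 lift_modeE /= eq_sym.
  rewrite (@ordS1 _ k (Ordinal (ltn_pmod k.+1 (pow2_gt0 m)))) // lift_modeE !phase_stateE /=.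
  by rewrite omega_powS // !mulrA [0 == u]eq_sym.
have au : a *m a ^t* = 1%:M.
  apply/matrixP => s u; rewrite !mxE big_ord_recl big_ord1 !mxE.
  by case: s => [[|[|]]] //= ?; case: u => [[|[|]]] //= ?;
    rewrite ?rmorphM ?rmorph0 ?rmorph1 ?mulr0 ?mulr1 ?mul0r ?add0r ?addr0 ?mul1r /= ?ww ?mulr0.
exists a; split=> //.
(* Unitarity of [a] and the relation for the adjoint of [A] write [E] as that adjoint times [E]
   times the adjoint of [a]; multiplying by [A] gives the other relation. *)
rewrite -[E in LHS]mulmx1 -au [E *m (_ *m _)]mulmxA -AE !mulmxA.
by have /unitarymxP -> := A_unitary R m; rewrite mul1mx.
Qed.

Lemma tr_Rot_lift_mode L (T B J : R) : exists q, (Rot m L T B J)^T *m E = E *m q.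
Proof.
have [a [aE aE']] := A_lift_mode.
have onE G : on_last m G *m E = E *m G by exact: mul_tens_lift_mode.
have step l : (R0 m L T B *m R1 m L T J l)^T *m E
    = E *m (a ^t* *m S1 L T J l *m a *m S0 L T B).
  by rewrite tr_step; exact: (intertwine4 aE aE' (onE _) (onE _)).
rewrite tr_Rot; elim: (index_enum _) => [|l r [q IH]].
  by exists 1%:M; rewrite big_nil mul1mx mulmx1.
exists (a ^t* *m S1 L T J l *m a *m S0 L T B *m q).
by rewrite big_cons -[LHS]mulmxA IH mulmxA step -[LHS]mulmxA.
Qed.

Lemma tr_Rot_unitary L (T B J : R) : (Rot m L T B J)^T \is unitarymx.
Proof.
rewrite tr_Rot; elim: (index_enum _) => [|l r IH].
  by rewrite big_nil; apply/unitarymxP; rewrite scalar1_tC mulmx1.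
rewrite big_cons; apply: mul_unitarymx IH; rewrite tr_step.
have Su t : rotmx t PY \is @unitarymx C 2 2 by apply: rotmx_unitary; rewrite ?PY_tC ?PY2.
have Au := A_unitary R m.
apply: mul_unitarymx; last by apply: on_last_unitary; rewrite S0E.
apply: mul_unitarymx; last by rewrite trmxC_unitary.
by apply: mul_unitarymx Au _; apply: on_last_unitary; rewrite S1E.
Qed.

(** Y is imaginary, so i Y is real. *)
Lemma rotmx_PY_real (t : R) : map_mx Num.conj (rotmx t PY) = rotmx t PY.
Proof.
apply/matrixP => i j; rewrite mxE !rotmxE rmorphD !rmorphM /= conjCi !conj_real rmorph_nat.
by congr (_ + _); rewrite PY_conj mulrN mulNr mulNr opprK.
Qed.

Lemma tr_Rot_real L (T B J : R) : map_mx Num.conj (Rot m L T B J)^T = (Rot m L T B J)^T.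
Proof.
have Ar : map_mx Num.conj A = A by apply/matrixP => i j; rewrite mxE !AE rmorph_nat.
have Sr t : map_mx Num.conj (on_last m (rotmx t PY)) = on_last m (rotmx t PY) :> 'M[C]_(N * 2).
  by rewrite /on_last map_mxT rotmx_PY_real map_scalar_mx rmorph1.
rewrite tr_Rot; elim: (index_enum _) => [|l r IH].
  by rewrite big_nil map_scalar_mx rmorph1.
rewrite big_cons map_mxM IH; congr (_ *m _).
have Ar' : map_mx Num.conj (A ^t*) = A ^t* by rewrite A_tC_tr -map_trmx Ar.
rewrite tr_step (S1E L T J l) (S0E L T B).
exact: (map_mx_fix4 Ar (Sr _) Ar' (Sr _)).
Qed.

End Phases.

(** * Quadratic forms transported through an intertwiner *)

Section Forms.
Variables (R : realType) (n : nat).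
Local Notation C := R[i].
Implicit Types (W Y : 'M[C]_n) (V : 'M[C]_(n, 2)) (q P : 'M[C]_2) (x : 'cV[C]_2).

Lemma intertwined_form W Y V q P x : V ^t* *m V = 1%:M -> W *m V = V *m q -> Y *m V = V *m P ->
  (V *m x) ^t* *m (W ^t* *m Y *m W) *m (V *m x) = x ^t* *m ((q ^t* *m P *m q) *m x).
Proof.
move=> V1 WV YV.
have e : W *m (V *m x) = V *m (q *m x) by rewrite mulmxA WV mulmxA.
transitivity ((W *m (V *m x)) ^t* *m (Y *m (W *m (V *m x)))).
  by rewrite [(W *m _) ^t*]mulmx_tC !mulmxA.
rewrite e [Y *m _]mulmxA YV [(V *m _) ^t*]mulmx_tC -!mulmxA [V ^t* *m _]mulmxA.
by rewrite V1 mul1mx mulmx_tC !mulmxA.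
Qed.

(** W V is an isometry, which makes the adjoint of [q] a left inverse. As [q] is square it is also a
    right inverse, the form used to compute the trace of the conjugated Y. *)
Lemma intertwiner_unitary W V q : W \is unitarymx -> V ^t* *m V = 1%:M -> W *m V = V *m q ->
  q *m q ^t* = 1%:M.
Proof.
move=> Wu V1 WV; apply: mulmx1C.
transitivity ((V *m q) ^t* *m (V *m q)).
  by rewrite mulmx_tC -mulmxA [V ^t* *m _]mulmxA V1 mul1mx.
rewrite -WV mulmx_tC -mulmxA [W ^t* *m _]mulmxA unitarymx_tCK // mul1mx.
exact: V1.
Qed.

(** Y is imaginary, which costs a sign; [plus_y_form] costs another, and the two cancel in
    [conj_mode_form]. *)
Lemma conj_conj_form q : map_mx Num.conj (q ^t* *m PY *m q)
  = - ((map_mx Num.conj q) ^t* *m PY *m map_mx Num.conj q).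
Proof.
have PYc : map_mx Num.conj (PY : 'M[C]_2) = - PY.
  by apply/matrixP => i j; rewrite mxE PY_conj [RHS]mxE.
by rewrite map_mxM map_mxM PYc mulmxN mulNmx map_trmx.
Qed.

(** Inserting [U] times its adjoint between the two factors turns the expectation into the squared
    norm of the evolved operator applied to [v]. *)
Lemma conj_square_form k (U b : 'M[C]_k) (v : 'cV[C]_k) : U *m U ^t* = 1%:M ->
  v ^t* *m (U ^t* *m (b ^t* *m b) *m U) *m v
  = ((U ^t* *m b *m U) *m v) ^t* *m ((U ^t* *m b *m U) *m v).
Proof.
move=> U1; have e : (U ^t* *m b *m U) ^t* = U ^t* *m (b ^t* *m U).
  by rewrite mulmx_tC (mulmx_tC (U ^t*)) trmxCK.
by rewrite [in RHS](mulmx_tC _ v) e -!mulmxA (mulmxA U (U ^t*)) U1 mul1mx.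
Qed.

Lemma scaled_form k (a : C) (v : 'cV[C]_k) (M : 'M[C]_k) : a^* = a ->
  (a *: v) ^t* *m M *m (a *: v) = (a * a) *: (v ^t* *m M *m v).
Proof.
move=> ar; have -> : (a *: v) ^t* = a *: v ^t*.
  by apply/matrixP => i j; rewrite !mxE rmorphM /= ar.
by rewrite -scalemxAl -scalemxAl -scalemxAr scalerA.
Qed.

Lemma tC_conj p r (M : 'M[C]_(p, r)) : (map_mx Num.conj M) ^t* = map_mx Num.conj (M ^t*).
Proof. by apply/matrixP => i j; rewrite !mxE. Qed.

(* A real orthogonal W that intertwines the momentum modes V with a unitary q of C^2 gives the
   mode of opposite momentum the same expectation, because q^* PY q is traceless. *)
Lemma conj_mode_form W W' Y V q : W \is unitarymx -> map_mx Num.conj W = W -> W ^t* = W' ->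
  V ^t* *m V = 1%:M -> W *m V = V *m q -> Y *m V = V *m PY ->
  Y *m map_mx Num.conj V = map_mx Num.conj V *m PY ->
  ((map_mx Num.conj V *m plus_y R) ^t* *m (W' *m Y *m W) *m (map_mx Num.conj V *m plus_y R)) 0 0
  = ((V *m plus_y R) ^t* *m (W' *m Y *m W) *m (V *m plus_y R)) 0 0.
Proof.
move=> Wu Wr <- V1 WV YV YVc.
have V1c : (map_mx Num.conj V) ^t* *m map_mx Num.conj V = 1%:M.
  by rewrite tC_conj -map_mxM V1 map_scalar_mx rmorph1.
have WVc : W *m map_mx Num.conj V = map_mx Num.conj V *m map_mx Num.conj q.
  by rewrite -{1}Wr -!map_mxM WV.
rewrite (intertwined_form (plus_y R) V1c WVc YVc) (intertwined_form (plus_y R) V1 WV YV).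
have qq := intertwiner_unitary Wu V1 WV.
rewrite -[_ *m map_mx _ q]opprK -conj_conj_form mulNmx mulmxN mxE plus_y_form ?opprK //.
  by rewrite mulmx_tC (mulmx_tC (q ^t*)) trmxCK PY_tC mulmxA.
rewrite mxtrace_mulC mulmxA qq mul1mx /mxtrace big_ord_recl big_ord1 !mxE.
by rewrite addr0.
Qed.

End Forms.

Lemma plus_y_norm (R : realType) : (plus_y R) ^t* *m plus_y R = 1%:M.
Proof.
apply/matrixP => a b; rewrite !mxE big_ord_recl big_ord1 !mxE !ord1 /=.
rewrite rmorphM /= conj_invsqrt2 conjCi sqr_invsqrt2 mulrACA sqr_invsqrt2 mulNr -expr2 sqrCi opprK.
by rewrite mul1r half1.
Qed.

(** * The occupation of b_1 as an expectation in Phi *)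

Section Expectation.
Variables (R : realType) (m L : nat) (T B J : R).
Local Notation C := R[i].
Local Notation N := (2 ^ m)%N.
Local Notation U := (Uevol N L T B J).
Local Notation Q := (Rot m L T B J).
Local Notation psi := (phase_state R m).
Local Notation E := (lift_mode psi).

(** [Uevol] and [Rot] list their steps in the same order and [heisenbergM] keeps it, so the two
    products are matched factor by factor. *)
Lemma heisenberg_Uevol : heisenberg (@maj R N) U Q /\ U \is unitarymx.
Proof.
have mC := maj_clifford R N.
have m1C : clifford (@maj1 R N) by exact: clifford_inj (@ordS_inj _) mC.
have U0E : U0 N L T B = pair_evol (@maj R N) (B * Delta L T) by rewrite /U0 H0_pair.
have U1E l : U1 N L T J l = pair_evol (@maj1 R N) (J * (l%:R / L%:R) * Delta L T).
  rewrite /U1 /pair_evol.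
  congr (expmx (_ *: _)).
  exact: H1_pair.
have h0 : heisenberg (@maj R N) (U0 N L T B) (R0 m L T B).
  by rewrite U0E R0E; exact: heisenberg_pair_evol.
have h1 l : heisenberg (@maj R N) (U1 N L T J l) (R1 m L T J l).
  rewrite U1E R1E'; apply: heisenberg_shift; rewrite /on_last -rotmx_tens1.
  exact: heisenberg_pair_evol.
have u0 : U0 N L T B \is unitarymx by rewrite U0E; exact: pair_evol_unitary.
have u1 l : U1 N L T J l \is unitarymx by rewrite U1E; exact: pair_evol_unitary.
rewrite /Uevol /Rot; elim: (index_enum _) => [|l r [IH1 IH2]].
  rewrite !big_nil; split; first exact: heisenberg1.
  by apply/unitarymxP; rewrite scalar1_tC mulmx1.
rewrite !big_cons; split.
  exact: (heisenbergM (heisenbergM h0 (h1 (rev_ord l))) IH1).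
exact: (mul_unitarymx (mul_unitarymx u0 (u1 (rev_ord l))) IH2).
Qed.

(** The coefficients of b_1 in the Majorana operators: the conjugated plane wave carries the phases
    of [bferm1], and the scale 1/sqrt 2 completes that of [plus_y] to the 1/2 in [cferm]. *)
Definition bmode : 'cV[C]_(N * 2) := (sqrtC 2%:R)^-1 *: (map_mx Num.conj E *m plus_y R).

Lemma bmodeE k s : bmode (mxtens_index (k, s)) 0
  = (sqrtC N%:R)^-1 * expi (- (2%:R * pi * k%:R / N%:R)) * (if s == 0 then 2^-1 else 'i / 2%:R).
Proof.
rewrite mxE lift_mode_conj lift_mode_mul [map_mx _ _ _ _]mxE phase_stateE rmorphM /= invsqrtN_conj.
rewrite omega_powE [plus_y _ _ _]mxE.
rewrite mulrCA; congr (_ * _); case: ifP => _; first exact: sqr_invsqrt2.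
by rewrite mulrCA sqr_invsqrt2.
Qed.

Lemma bferm1E : bferm1 R N = \sum_a bmode a 0 *: maj R a.
Proof.
rewrite /bferm1 scaler_sumr sum_mxtens; apply: eq_bigr => k _.
rewrite big_ord_recl big_ord1 (_ : lift ord0 ord0 = 1); last exact: val_inj.
rewrite !bmodeE /= /cferm /maj /= addn0 addn1 muln2.
by rewrite !scalerDr !scalerA (mulrC 'i 2^-1) !mulrA.
Qed.

Local Notation Ec := (map_mx Num.conj E).

Lemma E_tCK : E ^t* *m E = 1%:M.
Proof. exact: lift_mode_tCK (phase_state_norm R m). Qed.

Lemma Ec_tCK : Ec ^t* *m Ec = 1%:M.
Proof.
have := congr1 (map_mx Num.conj) E_tCK; rewrite map_mxM map_scalar_mx rmorph1 => <-.
by rewrite map_trmx.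
Qed.

Lemma bmode_form (M : 'M[C]_(N * 2)) :
  (bmode ^t* *m M *m bmode) 0 0
  = 2^-1 * ((Ec *m plus_y R) ^t* *m M *m (Ec *m plus_y R)) 0 0.
Proof.
by rewrite /bmode (scaled_form _ _ (conj_invsqrt2 R)) sqr_invsqrt2 mxE.
Qed.

(** This is the additive constant of the occupation: R^T is unitary, so the evolved coefficients
    keep this norm. *)
Lemma bmode_norm : (bmode ^t* *m bmode) 0 0 = 2^-1.
Proof.
rewrite -[bmode ^t*]mulmx1 bmode_form mulmx1 mulmx_tC -mulmxA [Ec ^t* *m _]mulmxA Ec_tCK mul1mx.
by rewrite plus_y_norm mxE mulr1.
Qed.

Lemma tr_Rot_tC : (Q^T) ^t* = Q.
Proof. by rewrite -map_trmx tr_Rot_real trmxK. Qed.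

Lemma expect_PhiE (M : 'M[C]_(N * 2)) :
  expect (Phi R m) M = ((E *m plus_y R) ^t* *m M *m (E *m plus_y R)) 0 0.
Proof. by rewrite /expect /Phi lift_mode_tens. Qed.

Lemma bmode_expect : (bmode ^t* *m (Q *m Ym R m *m Q^T) *m bmode) 0 0
  = 2^-1 * expect (Phi R m) (Q *m Ym R m *m Q^T).
Proof.
have [q WE] := tr_Rot_lift_mode m L T B J.
have YE : Ym R m *m E = E *m PY by exact: mul_tens_lift_mode.
have YEc : Ym R m *m Ec = Ec *m PY by rewrite lift_mode_conj; exact: mul_tens_lift_mode.
have form := conj_mode_form (tr_Rot_unitary m L T B J) (tr_Rot_real m L T B J) tr_Rot_tC
  E_tCK WE YE YEc.
exact: etrans (bmode_form _) (congr1 _ (etrans form (esym (expect_PhiE _)))).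
Qed.

Lemma expect_Bobs : expect (ket0 R N) (U ^t* *m Bobs R N *m U)
  = 2%:R^-1 - 2%:R^-1 * expect (Phi R m) (Q *m Ym R m *m Q^T).
Proof.
have [hU Uu] := heisenberg_Uevol.
(* The coefficients of the evolved b_1; the transpose arises because [heisenberg] expands along the
   rows of [Q]. *)
pose w := Q^T *m bmode.
have bU : U ^t* *m bferm1 R N *m U = \sum_b w b 0 *: maj R b.
  rewrite bferm1E mulmx_sumr mulmx_suml.
  under eq_bigr do rewrite -scalemxAr -scalemxAl hU scaler_sumr.
  rewrite exchange_big; apply: eq_bigr => b _; rewrite mxE scaler_suml.
  by apply: eq_bigr => a _; rewrite scalerA [Q^T b a]mxE mulrC.
have -> : expect (ket0 R N) (U ^t* *m Bobs R N *m U) =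
   (((\sum_b w b 0 *: maj R b) *m ket0 R N) ^t* *m ((\sum_b w b 0 *: maj R b) *m ket0 R N)) 0 0.
  rewrite -bU /expect /Bobs; have /unitarymxP U1 := Uu.
  exact: (congr1 (fun M : 'M[C]_1 => M 0 0) (conj_square_form (bferm1 R N) (ket0 R N) U1)).
rewrite norm_maj_sum -bmode_expect -bmode_norm; congr (_ - _).
  by rewrite /w mulmx_tC -mulmxA [(Q^T) ^t* *m _]mulmxA (unitarymx_tCK (tr_Rot_unitary _ _ _ _ _)) mul1mx.
by rewrite /w mulmx_tC tr_Rot_tC !mulmxA.
Qed.

End Expectation.

(** * Circuits for A and for one step; the total Ising time *)

Section ShiftCircuit.
Variables (R : realType) (m : nat).
Local Notation C := R[i].
Local Notation A := (A R m).

Lemma dim_m1 : (2 ^ m * 2 = 2 ^ m.+1)%N. Proof. by rewrite expnSr. Qed.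
Lemma dim_m2 : (2 ^ m * 2 * 2 = 2 ^ m.+2)%N. Proof. by rewrite !expnSr. Qed.

Lemma A_pmx : A = pmx R (2 ^ m * 2) (inc m.+1 0).
Proof.
by apply/matrixP => i j; rewrite AE mxE -val_eqE /= /inc expn0 addn1 expnSr.
Qed.

(** The auxiliary qubit is the new wire 0 and is left alone, so the increment starts at wire 1. *)
Lemma with_aux_A : with_aux A = pmx R (2 ^ m * 2 * 2) (inc m.+2 1).
Proof.
apply/matrixP => i j; case: (mxtens_indexP i) => a u; case: (mxtens_indexP j) => b v.
rewrite tensmxE AE !mxE -natrM mulnb /inc /=.
have -> : (b * 2 + v + 2 ^ 1 = b.+1 * 2 + v)%N by rewrite mulSn expn1; lia.
have -> : (2 ^ m.+2 = 2 ^ m * 2 * 2)%N by rewrite dim_m2.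
by rewrite modn_MD // eq_addl_mul.
Qed.

Lemma with_aux_on_last (G : 'M[C]_2) : with_aux (on_last m G) = gate1 (2 ^ m * 2 * 2) 1 G.
Proof.
apply: aux_matrixP => k s u k' s' u'; rewrite !tensmxE !mxE /=.
have d4 (x : 'I_(2 ^ m)) (y z : 'I_2) : (((x * 2 + y) * 2 + z) %/ 2 ^ 2 = x)%N.
  rewrite (_ : (x * 2 + y) * 2 + z = x * 2 ^ 2 + (y * 2 + z))%N; last by lia.
  by rewrite divnMDl // divn_small ?addn0 //; have := ltn_ord y; have := ltn_ord z; lia.
have m2 (x : 'I_(2 ^ m)) (y z : 'I_2) : (((x * 2 + y) * 2 + z) %% 2 ^ 1 = z)%N.
  by rewrite expn1 modnMDl modn_small.
have q1 (x : 'I_(2 ^ m)) (y z : 'I_2) : inord (qbit 1 ((x * 2 + y) * 2 + z)%N) = y.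
  rewrite /qbit expn1 divnMDl // [(z %/ 2)%N]divn_small // addn0 oddD oddM andbF /=.
  by apply: val_inj; rewrite /= inordK; case: y => [[|[|]]].
rewrite !d4 !m2 !q1 !val_eqE.
by case: (k == k'); case: (u == u'); rewrite /= ?mul1r ?mulr1 ?mul0r ?mulr0.
Qed.

(** The full ripple down to wire 0: gate [t] is controlled by all lower wires, so the gate on wire 0
    is the only plain X. *)
Lemma A_mcX : exists s : seq ({set 'I_m.+1} * 'I_m.+1),
  [/\ size s = m.+1, count (fun g => g.1 == finset.set0) s = 1%N,
      forall g, g \in s -> g.2 \notin g.1
    & A = \prod_(g <- s) mcX R (2 ^ m * 2) g.1 g.2].
Proof.
exists [seq ([set c : 'I_m.+1 | (c < t)%N], t) | t : 'I_m.+1 <- index_enum 'I_m.+1]; split.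
- by rewrite size_map [index_enum _]unlock -enumT size_enum_ord.
- rewrite count_map (eq_count (a2 := pred1 ord0)); first by rewrite count_uniq_mem ?index_enum_uniq // mem_index_enum.
  move=> t /=; apply/eqP/eqP => [/setP/(_ ord0)|->].
    by rewrite !inE; case: t => [[|t] ?] //= _; exact: val_inj.
  by apply/setP => c; rewrite !inE ltn0.
- by move=> g /mapP[t _ ->]; rewrite inE ltnn.
rewrite big_map A_pmx /=.
have := prod_mcX R dim_m1 (leq0n m.+1); rewrite (eq_bigl xpredT) // => ->.
by apply: eq_pmx => k _; rewrite low0.
Qed.

Lemma A_circuit : circuit m.+1 (2 * (m.+1 * (5 * m.+1 + 1)) + m.+1) A.
Proof. by rewrite A_pmx; exact: (circuit_inc R dim_m1). Qed.

Lemma with_aux_A_circuit :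
  circuit m.+2 (2 * (m.+2 * (5 * m.+2 + 1)) + m.+2) (with_aux A).
Proof. by rewrite with_aux_A; exact: (circuit_inc R dim_m2). Qed.

Lemma S0_unitary L (T B : R) : S0 L T B \is unitarymx.
Proof. by rewrite S0E; apply: rotmx_unitary; rewrite ?PY_tC ?PY2. Qed.

Definition gateH : 'M[C]_(2 ^ m * 2 * 2) := with_aux (on_last m (Htilde R)).

Lemma gateH_unitary : gateH \is unitarymx.
Proof. exact: (with_aux_unitary (on_last_unitary _ (Htilde_unitary R))). Qed.

(** [Htilde] leaves [S1tilde] and joins the gates on either side, so that [ising] remains as the
    only factor with [J]. *)
Lemma Vtilde_split L (T B J : R) l :
  Vtilde m L T B J l = (with_aux A *m gateH) *m on_last_aux m (ising J (tau L T l))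
     *m (gateH *m with_aux (A ^t*) *m with_aux (on_last m (S0 L T B))).
Proof.
rewrite /Vtilde /S1tilde !on_last_auxM.
have -> : on_last_aux m (Htilde R *t 1%:M) = gateH by rewrite on_last_aux_tens.
by rewrite !mulmxA.
Qed.

Lemma sum_tau L (T : R) : (1 <= L)%N -> \sum_(l < L.+1) tau L T l = T.
Proof.
move=> L1; have L0 : (L%:R : R) != 0 by rewrite pnatr_eq0 -lt0n.
have L2 : (L.+1%:R : R) != 0 by rewrite pnatr_eq0.
(* The value L (L + 1) / 2 cancels against the 2 / L of [tau] and the L + 1 in [Delta]. *)
have S n : \sum_(l < n.+1) (l%:R : R) = n%:R * n.+1%:R / 2%:R.
  elim: n => [|n IH]; first by rewrite big_ord_recl big_ord0 addr0 !mul0r.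
  by rewrite big_ord_recr /= IH -!natr1; field.
have -> : \sum_(l < L.+1) tau L T l = (\sum_(l < L.+1) (l%:R : R)) * (2%:R * Delta L T / L%:R).
  by rewrite mulr_suml; apply: eq_bigr => l _; rewrite /tau; field.
rewrite S /Delta; move: (L.+1%:R : R) (L%:R : R) L2 L0 => x y x0 y0; field.
by rewrite x0 y0.
Qed.

Lemma plus_norm : (plus R) ^t* *m plus R = 1%:M.
Proof.
apply/matrixP => a b; rewrite !mxE big_ord_recl big_ord1 !mxE !ord1 /=.
by rewrite conj_invsqrt2 sqr_invsqrt2 half1.
Qed.

Lemma expect_tens_plus (v : 'cV[C]_(2 ^ m * 2)) M :
  expect (v *t plus R : 'cV[C]_(2 ^ m * 2 * 2)) (with_aux M) = expect v M.
Proof.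
have e : (v *t plus R) ^t* *m (M *t 1%:M) *m (v *t plus R) = (v ^t* *m M *m v) *t (1%:M : 'M[C]_1).
  by rewrite tens_tC !tensmx_mul mulmx1 plus_norm.
have := congr1 (fun X : 'M[C]_(1 * 1) => X 0 0) e; rewrite [X in _ = X]mxE [X in _ * X]mxE.
by rewrite !ord1 mulr1.
Qed.

Lemma expect_psi_out L (T B J : R) :
  expect (Phi R m) (Rot m L T B J *m Ym R m *m (Rot m L T B J)^T)
  = expect (psi_out m L T B J) (with_aux (Ym R m)).
Proof.
rewrite -psi_outE expect_tens_plus /expect (mulmx_tC _ (Phi R m)) tr_Rot_tC.
by rewrite !mulmxA.
Qed.

End ShiftCircuit.

(** The order of the quantifiers expresses two claims: the unitaries and gate lists around the Ising
    evolution are chosen before [J], hence do not involve it, and [K] is chosen before [m], which is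
    the O(m^2). The constant 1/2 makes both sides of (1) vanish when B = J = 0. *)
Theorem mainTheorem2 (R : realType) :
  exists K : nat, forall (m L : nat) (T B : R),
  (1 <= m)%N -> (1 <= L)%N -> 0 < T ->
  [/\ (* (1) *)
      forall J : R,
        let U := Uevol (2 ^ m) L T B J in
        let Q := Rot m L T B J in
        expect (ket0 R (2 ^ m)) (U ^t* *m Bobs R (2 ^ m) *m U)
        = 2%:R^-1 - 2%:R^-1 * expect (Phi R m) (Q *m Ym R m *m Q^T),
      (* (2) *)
      [/\ (R0 m L T B)^T = on_last m (S0 L T B),
          forall (J : R) (l : nat), (l <= L)%N ->
            (R1 m L T J l)^T = A R m *m on_last m (S1 L T J l) *m (A R m) ^t*,
          forall J : R,
            ((Rot m L T B J)^T *m Phi R m) *t plus R = psi_out m L T B J,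
          forall l : nat, (l <= L)%N ->
            exists P Q : 'M[R[i]]_(2 ^ m * 2 * 2),
            [/\ P \is unitarymx, Q \is unitarymx &
                forall J : R, Vtilde m L T B J l
                  = P *m on_last_aux m (ising J (tau L T l)) *m Q]
        & forall J : R,
            let U := Uevol (2 ^ m) L T B J in
            expect (ket0 R (2 ^ m)) (U ^t* *m Bobs R (2 ^ m) *m U)
            = 2%:R^-1
              - 2%:R^-1 * expect (psi_out m L T B J) (with_aux (Ym R m))]
    & (* (3) *)
      [/\ exists s : seq ({set 'I_m.+1} * 'I_m.+1),
            [/\ size s = m.+1,
                count (fun g => g.1 == finset.set0) s = 1%N,
                forall g, g \in s -> g.2 \notin g.1
              & A R m = \prod_(g <- s) mcX R (2 ^ m * 2) g.1 g.2],
          exists s : seq 'M[R[i]]_(2 ^ m * 2),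
            [/\ elementary_circuit m.+1 s, (size s <= K * m ^ 2)%N
              & A R m = \prod_(G <- s) G],
          forall l : nat, (l <= L)%N ->
            exists s1 s2 : seq 'M[R[i]]_(2 ^ m * 2 * 2),
            [/\ elementary_circuit m.+2 s1, elementary_circuit m.+2 s2,
                (size s1 + size s2 <= K * m ^ 2)%N
              & forall J : R, Vtilde m L T B J l
                  = (\prod_(G <- s1) G) *m on_last_aux m (ising J (tau L T l))
                    *m (\prod_(G <- s2) G)]
        & \sum_(l < L.+1) tau L T l = T]].
Proof.
(* A step uses [A], its adjoint, [Htilde] twice and [S0]: at most 2 (m + 2) (10 m + 23) + 3 gates.
   This quadratic has nonnegative coefficients, so for m >= 1 it is at most m^2 times its value at m
   = 1, which is 201. *)
exists 201%N => m L T B m1 L1 T0; split.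
- by move=> J; exact: expect_Bobs.
- split.
  + exact: tr_R0.
  + by move=> J l _; exact: tr_R1.
  + by move=> J; exact: psi_outE.
  + move=> l _; exists (with_aux (A R m) *m gateH R m),
      (gateH R m *m with_aux ((A R m) ^t*) *m with_aux (on_last m (S0 L T B))); split.
    * by apply: mul_unitarymx (gateH_unitary R m); exact/with_aux_unitary/A_unitary.
    * apply: mul_unitarymx; last exact/with_aux_unitary/on_last_unitary/S0_unitary.
      apply: mul_unitarymx (gateH_unitary R m) _.
      by apply: with_aux_unitary; rewrite trmxC_unitary; exact: A_unitary.
    * by move=> J; exact: Vtilde_split.
  + move=> J /=; rewrite expect_Bobs; congr (_ - _ * _).
    exact: expect_psi_out.
- split.
  + exact: A_mcX.
  + have [s [es ss As]] := A_circuit R m; exists s; split=> //.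
    by apply: leq_trans ss _; nia.
  + move=> l _.
    have Hc : circuit m.+2 1 (gateH R m).
      rewrite /gateH with_aux_on_last; apply: (circuit_gate1 _ _ (Htilde_unitary R)) => //.
    have Sc : circuit m.+2 1 (with_aux (on_last m (S0 L T B))).
      rewrite with_aux_on_last; apply: (circuit_gate1 _ _ (S0_unitary L T B)) => //.
    have Ac := with_aux_A_circuit R m.
    have Ac' := circuit_tC Ac; rewrite with_aux_tC in Ac'.
    have [s1 [e1 l1 p1]] := circuitM Ac Hc.
    have [s2 [e2 l2 p2]] := circuitM (circuitM Hc Ac') Sc.
    exists s1, s2; split=> //; last by move=> J; rewrite -p1 -p2; exact: Vtilde_split.
    by apply: leq_trans (leq_add l1 l2) _; nia.
  + exact: sum_tau.
Qed.
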